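(* Consider the linear system $x_{t+1}=\theta^* z_t+w_t$, $t\ge 0$, with $z_t=(x_t^\top,u_t^\top)^\top\in\mathbb{R}^{n_z}$, $n_z=n_x+n_u$, and $\theta^*\in\mathbb{R}^{n_x\times n_z}$, and suppose that Assumptions (A) (compactly and convexly supported i.i.d. noise), (B) (bounded $z_t$ and BMSB condition with constants $b_z,\sigma_z,p_z$) and (C) (pointwise boundary-visiting noise with function $q_w$), all spelled out in the context, hold. Let $a_1=\frac14\sigma_zp_z$, $a_2=\max\{1,\frac{64b_z^2}{\sigma_z^2p_z^2}\}$, $a_3=\frac18p_z^2$, $a_4=\max\{1,\frac{4b_z}{a_1}\}$. Then for any $T,m$ with $1\le m<T$ and any $\delta>0$, the membership set $\Theta_T=\bigcap_{t=0}^{T-1}\{\hat\theta\in\mathbb{R}^{n_x\times n_z}: x_{t+1}-\hat\theta z_t\in\mathbb{W}\}$ satisfies $$\mathbb{P}\left(\mathrm{diam}(\Theta_T)>\delta\right)\le \frac{T}{m}\,\tilde O(n_z^{5/2})\,a_2^{n_z}\exp(-a_3m)+\tilde O\left((n_xn_z)^{5/2}\right)a_4^{n_xn_z}\left[1-q_w\left(\tfrac{a_1\delta}{4}\right)\right]^{\lceil T/m\rceil-1}.$$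
   Context: Setting: $x_t\in\mathbb{R}^{n_x}$ is the state, $u_t\in\mathbb{R}^{n_u}$ the control input, $w_t\in\mathbb{R}^{n_x}$ the process noise; $x_{t+1}=A^*x_t+B^*u_t+w_t$ and $\theta^*=(A^*,B^* )$ is the unknown parameter. $T$ (number of stages of data) and $m$ are integers. Let $\mathcal{F}_t=\sigma\{w_0,\dots,w_{t-1},z_0,\dots,z_t\}$. Diameter: for $\Theta\subseteq\mathbb{R}^{n_x\times n_z}$, $\mathrm{diam}(\Theta)=\sup_{\theta_1,\theta_2\in\Theta}\|\theta_1-\theta_2\|_F$, with $\|\cdot\|_F$ the Frobenius norm. Assumption (A): $\{w_t\}_{t\ge0}$ are identically and independently sampled from a known compact convex set $\mathbb{W}\subseteq\mathbb{R}^{n_x}$ with non-empty interior, $\mathbb{E}(w_t)=0$, and $\mathrm{Cov}(w_t)=\Sigma_w\succ0$. Assumption (B): there is $b_z$ with $\|z_t\|_2\le b_z$ almost surely for all $t\ge0$; and for some $\sigma_z>0$ and $p_z\in(0,1]$ the process $\{z_t\}$, adapted to $\{\mathcal{F}_t\}$, satisfies the $(1,\sigma_z^2\mathbb{I}_{n_z},p_z)$-block-martingale small-ball (BMSB) condition: for every fixed unit vector $\lambda\in\mathbb{R}^{n_z}$ and all $t\ge1$, $\mathbb{P}(|\lambda^\top z_{t+1}|\ge\sigma_z\mid\mathcal{F}_t)\ge p_z$ almost surely. Assumption (C): for every $\epsilon>0$ there is $q_w(\epsilon)>0$ such that for all $t\ge0$ and all $w^0\in\partial\mathbb{W}$, $\mathbb{P}(\|w^0-w_t\|_2<\epsilon)\ge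 q_w(\epsilon)$. Notation: $\tilde O(\cdot)$ is big-O notation hiding logarithmic terms.
   Formalization: The formal theorem additionally assumes that each w_t is independent of F_t (inputs and initial state do not anticipate the noise); with only mutual independence of the w_t the claim fails, e.g. θ*=0, Rademacher w_t, W=[-1,1], u_t=w_t gives diam(Θ_T)≥2 for all T. *)

(* Defs.v *)
From mathcomp Require Export all_boot all_order all_algebra finmap.
From mathcomp Require Export all_classical all_reals all_analysis.

Set Implicit Arguments.
Unset Strict Implicit.
Unset Printing Implicit Defensive.

Import Order.TTheory GRing.Theory Num.Theory.
Import numFieldNormedType.Exports.

Local Open Scope classical_set_scope.
Local Open Scope ring_scope.

(* The norm that the library puts on matrices is the max norm, which is only
   used here for the topology (open, closed, compact sets) of 'M[R]_(m, n).
   On a column vector [frobenius] is the Euclidean norm. *)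
Definition frobenius (R : realType) (m n : nat) (M : 'M[R]_(m, n)) : R :=
  Num.sqrt (\sum_(i < m) \sum_(j < n) M i j ^+ 2).

(* The supremum is taken in \bar R: it is +oo on unbounded sets and -oo on the
   empty set. *)
Definition diam (R : realType) (m n : nat) (A : set 'M[R]_(m, n)) : \bar R :=
  ereal_sup [set (frobenius (p.1 - p.2))%:E | p in A `*` A].

Definition boundary (R : realType) (n : nat) (A : set 'cV[R]_n) :
  set 'cV[R]_n := closure A `\` interior A.

Definition positive_definite (R : realType) (n : nat) (S : 'M[R]_n) : Prop :=
  S^T = S /\ forall v : 'cV[R]_n, v != 0 -> 0 < (v^T *m S *m v) 0 0.

(* f = O~(g): the hidden factor is a power of the logarithm of the argument of f
   and g, independent of every other quantity in the context. *)
Definition soft_bigO (R : realType) (f g : nat -> R) : Prop :=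
  exists k : nat,
    (f : nat -> R^o) =O_\oo (fun n : nat => g n * ln (n%:R : R) ^+ k : R^o).

Section Probability.
Context (R : realType) (d : measure_display) (Omega : measurableType d).
Variable P : probability Omega R.

Definition borelV (n : nat) := g_sigma_algebraType (@open 'cV[R]_n).

Definition random_vector (n : nat) (X : Omega -> 'cV[R]_n) : Prop :=
  measurable_fun [set: Omega] (X : Omega -> borelV n).

Definition sigma_rv (n : nat) (X : Omega -> 'cV[R]_n) : set (set Omega) :=
  g_sigma_algebra_preimage (X : Omega -> borelV n).

Definition mutually_independent (n : nat) (X : nat -> Omega -> 'cV[R]_n) :
    Prop :=
  forall (J : {fset nat}) (E : nat -> set Omega),
    (forall j, j \in J -> sigma_rv (X j) (E j)) ->
    P (\bigcap_(j in [set` J]) E j) = (\prod_(j <- J) P (E j))%E.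

Definition identically_distributed (n : nat) (X : nat -> Omega -> 'cV[R]_n) :
    Prop :=
  forall (t : nat) (B : set (borelV n)), measurable B ->
    P (X t @^-1` B) = P (X 0%N @^-1` B).

Definition independent_of (F G : set (set Omega)) : Prop :=
  forall A B : set Omega, F A -> G B -> P (A `&` B) = (P A * P B)%E.

(* Conditional probabilities are only defined almost surely: g is one version of
   P(E | F). *)
Definition is_cond_prob (F : set (set Omega)) (E : set Omega)
    (g : Omega -> R) : Prop :=
  [/\ forall B : set R, measurable B -> F (g @^-1` B),
      P.-integrable [set: Omega] (EFin \o g) &
      forall A : set Omega, F A -> (\int[P]_(o in A) (g o)%:E)%E = P (E `&` A)].

Definition filtration (nx nz : nat) (w : nat -> Omega -> 'cV[R]_nx)
    (z : nat -> Omega -> 'cV[R]_nz) (t : nat) : set (set Omega) :=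
  <<s (\bigcup_(k in `I_t) sigma_rv (w k)) `|`
      (\bigcup_(k in `I_t.+1) sigma_rv (z k)) >>.

(* The noise w_t is sampled independently of the information available at time
   t, so that the input u_t cannot look into current or future noise.  Mutual
   independence of the w_t alone does not say so, and an input that reacts to
   w_t can keep the parameter unidentifiable. *)
Definition nonanticipative (nx nz : nat) (w : nat -> Omega -> 'cV[R]_nx)
    (z : nat -> Omega -> 'cV[R]_nz) : Prop :=
  forall t : nat, independent_of (sigma_rv (w t)) (filtration w z t).

Record iid_bounded_noise (nx : nat) (W : set 'cV[R]_nx)
    (w : nat -> Omega -> 'cV[R]_nx) (Sigmaw : 'M[R]_nx) : Prop := {
  noise_random : forall t, random_vector (w t) ;
  noise_independent : mutually_independent w ;
  noise_identically_distributed : identically_distributed w ;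
  noise_in_support : forall t, {ae P, forall o, W (w t o)} ;
  support_compact : compact W ;
  support_convex : convex_set (W : set (convex_lmodType 'cV[R]_nx)) ;
  support_interior : interior W !=set0 ;
  noise_centered : forall t i, ('E_P[(fun o => w t o i 0%R)] = 0)%E ;
  noise_covariance : forall t i j,
    covariance P (fun o => w t o i 0) (fun o => w t o j 0) = (Sigmaw i j)%:E ;
  noise_covariance_posdef : positive_definite Sigmaw
}.

(* The process z is adapted to [filtration w z] by construction. *)
Definition bmsb (nx nz : nat) (w : nat -> Omega -> 'cV[R]_nx)
    (z : nat -> Omega -> 'cV[R]_nz) (sigma p : R) : Prop :=
  forall (lambda : 'cV[R]_nz), frobenius lambda = 1 ->
  forall t : nat, (1 <= t)%N ->
  exists g : Omega -> R,
    is_cond_prob (filtration w z t)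
      [set o | sigma <= `| (lambda^T *m z t.+1 o) 0 0 |] g /\
    {ae P, forall o, p <= g o}.

Record bounded_bmsb (nx nz : nat) (w : nat -> Omega -> 'cV[R]_nx)
    (z : nat -> Omega -> 'cV[R]_nz) (bz sigmaz pz : R) : Prop := {
  z_bounded : forall t, {ae P, forall o, frobenius (z t o) <= bz} ;
  sigmaz_gt0 : 0 < sigmaz ;
  pz_range : 0 < pz <= 1 ;
  z_bmsb : bmsb w z sigmaz pz
}.

Definition boundary_visiting (nx : nat) (W : set 'cV[R]_nx)
    (w : nat -> Omega -> 'cV[R]_nx) (q : R -> R) : Prop :=
  forall eps : R, 0 < eps ->
    0 < q eps /\
    forall (t : nat) (w0 : 'cV[R]_nx), boundary W w0 ->
      ((q eps)%:E <= P [set o | (frobenius (w0 - w t o) < eps)%R])%E.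

Definition membership_set (nx nz : nat) (W : set 'cV[R]_nx)
    (x : nat -> Omega -> 'cV[R]_nx) (z : nat -> Omega -> 'cV[R]_nz)
    (T : nat) (o : Omega) : set 'M[R]_(nx, nz) :=
  \bigcap_(t in `I_T) [set theta | W (x t.+1 o - theta *m z t o)].

End Probability.

(* Main.v *)
Require Import Defs.
From mathcomp Require Import ring lra zify.

Set Implicit Arguments.
Unset Strict Implicit.
Unset Printing Implicit Defensive.

Import Order.TTheory GRing.Theory Num.Theory.
Import numFieldNormedType.Exports.

Local Open Scope classical_set_scope.
Local Open Scope ring_scope.

(** Fix a net of directions G on the Frobenius sphere of parameters and cut time
    into K = ceil(T/m) - 1 blocks of length m.  If diam(Theta_T) > delta, some
    theta' in Theta_T has an error of norm > delta/2; let G be a net point close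
    to its direction.
    - If in a block every vector of a net of the sphere of R^nz sees at least
      p m/2 of the z_t at level sigma, then sum_t |lambda^T z_t|^2 is large for
      all lambda; summing over the rows of the error direction, some z_t of the
      block is not small under G.  By the BMSB condition and a Chernoff bound
      the assumption fails with probability of order exp(- p m/8) per block and
      net vector.
    - At the first time of a block at which G z_t is not small, the noise w_t
      must stay away from the boundary point of W that is extremal in the
      direction - G z_t, for otherwise w_t - (theta' - theta) z_t leaves W.
      As w_t is independent of the past, all blocks do so with probability at
      most (1 - q_w)^K.
    The union bounds need nets of size (c/eps)^N with an explicit c; rounding to
    a cubic grid and counting integer points in an l1-ball gives c = e up to
    lower order terms, which leaves room in a_2 and a_4, so that constants can
    be taken for f1 and f2. *)

(** * The Frobenius norm and the inner product of column vectors *)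

Section Frobenius.
Context {R : realType}.

(** Lagrange's identity: the sum over all pairs of [(a i * b j - a j * b i) ^+ 2] is twice the gap
    between the two sides. *)
Lemma cauchy_schwarz (I : finType) (a b : I -> R) :
  (\sum_i a i * b i) ^+ 2 <= (\sum_i a i ^+ 2) * (\sum_i b i ^+ 2).
Proof.
have H : 0 <= \sum_i \sum_j (a i * b j - a j * b i) ^+ 2.
  by apply: sumr_ge0 => i _; apply: sumr_ge0 => j _; exact: sqr_ge0.
have E : \sum_i \sum_j (a i * b j - a j * b i) ^+ 2 =
    ((\sum_i a i ^+ 2) * (\sum_i b i ^+ 2) - (\sum_i a i * b i) ^+ 2) *+ 2.
  rewrite mulr2n expr2 !mulr_suml.
  transitivity (\sum_i (\sum_j (a i ^+ 2 * b j ^+ 2 - a i * b i * (a j * b j))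
      + \sum_j (b i ^+ 2 * a j ^+ 2 - a i * b i * (a j * b j)))).
    apply: eq_bigr => i _; rewrite -big_split; apply: eq_bigr => j _ /=; ring.
  rewrite big_split /=; congr (_ + _).
    rewrite -sumrB; apply: eq_bigr => i _.
    by rewrite sumrB !mulr_sumr.
  under eq_bigr => i _ do rewrite sumrB -!mulr_sumr.
  rewrite sumrB -!mulr_suml mulrC; congr (_ - _).
by rewrite E pmulrn_lge0 // subr_ge0 in H.
Qed.

Definition sqnorm m n (M : 'M[R]_(m, n)) : R := \sum_i \sum_j M i j ^+ 2.

Definition dotv n (u v : 'cV[R]_n) : R := (u^T *m v) 0 0.

Lemma dotvE n (u v : 'cV[R]_n) : dotv u v = \sum_i u i 0 * v i 0.
Proof. by rewrite /dotv mxE; apply: eq_bigr => i _; rewrite mxE. Qed.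

Lemma sqnorm_ge0 m n (M : 'M[R]_(m, n)) : 0 <= sqnorm M.
Proof. by apply: sumr_ge0 => i _; apply: sumr_ge0 => j _; exact: sqr_ge0. Qed.

Lemma frob_ge0 m n (M : 'M[R]_(m, n)) : 0 <= frobenius M.
Proof. exact: sqrtr_ge0. Qed.

Lemma frob_sqr m n (M : 'M[R]_(m, n)) : frobenius M ^+ 2 = sqnorm M.
Proof. by rewrite sqr_sqrtr // sqnorm_ge0. Qed.

Lemma sqnorm_pair m n (M : 'M[R]_(m, n)) :
  sqnorm M = \sum_(p : 'I_m * 'I_n) M p.1 p.2 ^+ 2.
Proof. by rewrite /sqnorm pair_bigA. Qed.

Lemma frobN m n (M : 'M[R]_(m, n)) : frobenius (- M) = frobenius M.
Proof.
by rewrite /frobenius; congr Num.sqrt; apply: eq_bigr => i _; apply: eq_bigr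
  => j _; rewrite mxE sqrrN.
Qed.

Lemma frob_distC m n (M N : 'M[R]_(m, n)) :
  frobenius (M - N) = frobenius (N - M).
Proof. by rewrite -frobN opprB. Qed.

Lemma frobZ m n a (M : 'M[R]_(m, n)) : frobenius (a *: M) = `|a| * frobenius M.
Proof.
rewrite -sqrtr_sqr /frobenius -sqrtrM ?sqr_ge0 //; congr Num.sqrt.
rewrite mulr_sumr; apply: eq_bigr => i _; rewrite mulr_sumr.
by apply: eq_bigr => j _; rewrite mxE exprMn.
Qed.

Lemma frob0 m n : frobenius (0 : 'M[R]_(m, n)) = 0.
Proof. by rewrite -(scale0r 0) frobZ normr0 mul0r. Qed.

Lemma frob_triangle m n (M N : 'M[R]_(m, n)) :
  frobenius (M + N) <= frobenius M + frobenius N.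
Proof.
rewrite -(ler_pXn2r (n := 2)) // ?nnegrE ?addr_ge0 ?frob_ge0 //.
rewrite sqrrD !frob_sqr.
have -> : sqnorm (M + N) = sqnorm M + sqnorm N +
    (\sum_(p : 'I_m * 'I_n) M p.1 p.2 * N p.1 p.2) *+ 2.
  rewrite !sqnorm_pair -sumrMnl -!big_split; apply: eq_bigr => p _ /=.
  by rewrite mxE; ring.
rewrite addrAC; apply: lerD => //; apply: lerD => //.
rewrite lerMn2r /=.
apply: le_trans (ler_norm _) _.
rewrite -(ler_pXn2r (n := 2)) // ?nnegrE ?mulr_ge0 ?frob_ge0 //.
rewrite real_normK ?num_real // exprMn !frob_sqr !sqnorm_pair.
exact: cauchy_schwarz.
Qed.

Lemma frob_sub_ge m n (M N : 'M[R]_(m, n)) :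
  frobenius M - frobenius (M - N) <= frobenius N.
Proof. by have := frob_triangle (M - N) N; rewrite subrK; lra. Qed.

Lemma dotv_le n (u v : 'cV[R]_n) : `|dotv u v| <= frobenius u * frobenius v.
Proof.
rewrite -(ler_pXn2r (n := 2)) // ?nnegrE ?mulr_ge0 ?frob_ge0 //.
rewrite real_normK ?num_real // exprMn !frob_sqr dotvE /sqnorm.
under [X in _ <= X * _]eq_bigr do rewrite big_ord1.
under [X in _ <= _ * X]eq_bigr do rewrite big_ord1.
exact: cauchy_schwarz.
Qed.

Lemma dotvv n (u : 'cV[R]_n) : dotv u u = frobenius u ^+ 2.
Proof.
by rewrite frob_sqr dotvE; apply: eq_bigr => i _; rewrite big_ord1 expr2.
Qed.

Lemma dotvBr n (u v w : 'cV[R]_n) : dotv u (v - w) = dotv u v - dotv u w.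
Proof. by rewrite /dotv mulmxBr !mxE. Qed.

Lemma dotvDr n (u v w : 'cV[R]_n) : dotv u (v + w) = dotv u v + dotv u w.
Proof. by rewrite /dotv mulmxDr !mxE. Qed.

Lemma dotvBl n (u v w : 'cV[R]_n) : dotv (u - v) w = dotv u w - dotv v w.
Proof. by rewrite /dotv linearB mulmxBl !mxE. Qed.

Lemma dotvZl n a (u w : 'cV[R]_n) : dotv (a *: u) w = a * dotv u w.
Proof. by rewrite /dotv linearZ -scalemxAl !mxE. Qed.

Lemma dotvZr n a (u w : 'cV[R]_n) : dotv u (a *: w) = a * dotv u w.
Proof. by rewrite /dotv -scalemxAr !mxE. Qed.

Lemma dotvNl n (u w : 'cV[R]_n) : dotv (- u) w = - dotv u w.
Proof. by rewrite -scaleN1r dotvZl mulN1r. Qed.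

Lemma sqnorm_mulmxE m n (A : 'M[R]_(m, n)) (v : 'cV[R]_n) :
  sqnorm (A *m v) = \sum_i dotv (row i A)^T v ^+ 2.
Proof.
apply: eq_bigr => i _; rewrite big_ord1; congr (_ ^+ 2).
by rewrite dotvE mxE; apply: eq_bigr => j _; rewrite !mxE.
Qed.

Lemma sqnorm_rows m n (A : 'M[R]_(m, n)) :
  sqnorm A = \sum_i frobenius (row i A)^T ^+ 2.
Proof.
apply: eq_bigr => i _; rewrite frob_sqr /sqnorm.
by apply: eq_bigr => j _; rewrite big_ord1 !mxE.
Qed.

Lemma frob_mulmx m n (A : 'M[R]_(m, n)) (v : 'cV[R]_n) :
  frobenius (A *m v) <= frobenius A * frobenius v.
Proof.
rewrite -(ler_pXn2r (n := 2)) // ?nnegrE ?mulr_ge0 ?frob_ge0 //.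
rewrite exprMn !frob_sqr sqnorm_mulmxE sqnorm_rows mulr_suml.
apply: ler_sum => i _; rewrite -frob_sqr -exprMn -real_normK ?num_real //.
rewrite ler_pXn2r // ?nnegrE ?mulr_ge0 ?frob_ge0 //; exact: dotv_le.
Qed.

Lemma sqnorm_le_bound m n (M : 'M[R]_(m, n)) h : 0 <= h ->
  (forall i j, `|M i j| <= h) -> sqnorm M <= (m * n)%:R * h ^+ 2.
Proof.
move=> h0 H; rewrite sqnorm_pair.
rewrite [leRHS](_ : _ = \sum_(p : 'I_m * 'I_n) h ^+ 2).
  apply: ler_sum => i _; rewrite -real_normK ?num_real //.
  by rewrite ler_pXn2r ?nnegrE.
by rewrite sumr_const card_prod !card_ord mulr_natl.
Qed.

Lemma frob_le_bound m n (M : 'M[R]_(m, n)) h : 0 <= h ->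
  (forall i j, `|M i j| <= h) -> frobenius M <= (m * n)%:R * h.
Proof.
move=> h0 H; rewrite -(ler_pXn2r (n := 2)) // ?nnegrE ?mulr_ge0 ?frob_ge0 //.
rewrite frob_sqr exprMn (le_trans (sqnorm_le_bound h0 H)) //.
rewrite ler_wpM2r ?sqr_ge0 // -natrX ler_nat; case: (_ * _)%N => // k.
by rewrite expnS leq_pmulr // expn_gt0.
Qed.

Lemma entry_le_frob m n (M : 'M[R]_(m, n)) i j : `|M i j| <= frobenius M.
Proof.
rewrite -(ler_pXn2r (n := 2)) // ?nnegrE ?frob_ge0 //.
rewrite frob_sqr sqnorm_pair real_normK ?num_real // (bigD1 (i, j)) //=.
by rewrite lerDl sumr_ge0 // => p _; exact: sqr_ge0.
Qed.

Lemma frob_gt0 m n (M : 'M[R]_(m, n)) : M != 0 -> 0 < frobenius M.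
Proof.
move=> M0; rewrite lt_def frob_ge0 andbT; apply: contraNneq M0 => F0.
apply/eqP/matrixP => i j; rewrite mxE; apply/eqP.
by rewrite -normr_le0 -F0 entry_le_frob.
Qed.

Lemma continuous_mx (T : topologicalType) m n (f : T -> 'M[R]_(m, n)) :
  (forall i j, continuous (fun x => f x i j)) -> continuous f.
Proof.
move=> H x A [P nP PA]; apply: filterS PA _.
apply: filter_forall => i; apply: filter_forall => j.
exact: (H i j x) (nP i j).
Qed.

Lemma continuous_frob m n : continuous (@frobenius R m n).
Proof.
have H : continuous (fun M : 'M[R]_(m, n) => \sum_i \sum_j M i j ^+ 2).
  apply: continuous_big => [|i _]; first exact: add_continuous.
  apply: continuous_big => [|j _ M]; first exact: add_continuous.
  exact: (continuous_comp (@coord_continuous _ _ _ i j M)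
    (@exprn_continuous R 2 _)).
move=> M; exact: (continuous_comp (H M) (@sqrt_continuous R _)).
Qed.

End Frobenius.

(** * Nets of the unit sphere with an explicit cardinality *)

Section Nets.
Context {R : realType}.

(** The power 16 of 1 - 1/16 <= exp(-1/16) gives e <= (16/15)^16 < 2.81. *)
Lemma expR1_le : expR 1 <= 281%:R / 100%:R :> R.
Proof.
have H : expR (- (1 / 16%:R)) >= 15%:R / 16%:R :> R.
  by apply: le_trans (expR_ge1Dx _); lra.
have -> : (1 : R) = 1 / 16%:R * 16%:R by lra.
rewrite expRM_natr -[X in expR X]opprK expRN exprVn.
have H16 : (15%:R / 16%:R) ^+ 16 <= expR (- (1 / 16%:R)) ^+ 16 :> R.
  by rewrite lerXn2r ?nnegrE ?expR_ge0 //; lra.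
by rewrite -[leRHS]invrK lef_pV2 ?posrE ?exprn_gt0 ?expR_gt0 //; lra.
Qed.

(** The left side is coth(l/2), that is 1 + 2/(y - 1) with y = exp l; the quadratic lower bound on y
    is sharp enough up to l = 2/5. *)
Lemma coth_le (l : R) : 0 < l <= 2%:R / 5%:R ->
  (1 + expR (- l)) / (1 - expR (- l)) <= 2%:R / l + 36%:R / 100%:R.
Proof.
move=> /andP[l0 l1].
have y1 : (1 + l / 4%:R) ^+ 4 <= expR l.
  have -> : expR l = expR (l / 4%:R) ^+ 4 by rewrite -expRM_natr; congr expR; lra.
  by rewrite lerXn2r ?nnegrE ?expR_ge0 ?expR_ge1Dx //; lra.
have y2 : 1 + l + 3%:R / 8%:R * l ^+ 2 <= expR l.
  apply: le_trans y1.
  have : 0 <= l ^+ 3 * (16%:R + l) by rewrite mulr_ge0 ?exprn_ge0; lra.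
  nra.
have -> : 2%:R / l + 36%:R / 100%:R = (2%:R + 36%:R / 100%:R * l) / l.
  by field; lra.
set y := expR l in y1 y2 *; have yy : 1 + l <= y by nra.
have -> : (1 + expR (- l)) / (1 - expR (- l)) = (y + 1) / (y - 1).
  by rewrite expRN -/y; field; apply/andP; split; lra.
rewrite ler_pdivrMr ?subr_gt0; last lra.
rewrite mulrAC ler_pdivlMr //; nra.
Qed.

Lemma geometric_le (x : R) k : 0 <= x < 1 ->
  \sum_(i < k) x ^+ i <= (1 - x)^-1.
Proof.
move=> /andP[x0 x1]; rewrite -[leRHS]mul1r ler_pdivlMr; last lra.
have := subrX1 x k; set S := \sum_(i < k) _ => E.
have : 0 <= x ^+ k by rewrite exprn_ge0.
by nra.
Qed.

Lemma two_sided_geometric_le (B : nat) (x : R) : 0 <= x < 1 ->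
  \sum_(k < B + B.+1) x ^+ `|(k : nat)%:Z - B%:Z|%N <= (1 + x) / (1 - x).
Proof.
move=> x01; rewrite big_split_ord /=.
rewrite [X in X + _](_ : _ = x * \sum_(i < B) x ^+ i); last first.
  rewrite mulr_sumr (reindex_inj rev_ord_inj) /=; apply: eq_bigr => i _.
  by rewrite -exprS; congr (_ ^+ _); have := ltn_ord i; lia.
rewrite [X in _ + X](_ : _ = \sum_(i < B.+1) x ^+ i); last first.
  by apply: eq_bigr => i _; congr (_ ^+ _); lia.
have /andP[x0 x1] := x01; have G1 := geometric_le B x01.
have G2 := geometric_le B.+1 x01.
rewrite mulrDl mul1r addrC lerD // ler_wpM2l //.
Qed.

(** The l1 norm of a lattice point of the cube [-B, B]^I, whose coordinates are shifted by [B] to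
    become ordinals. *)
Definition grid_norm1 (I : finType) (B : nat) (f : {ffun I -> 'I_(B + B.+1)})
  : nat := \sum_p `|(f p : nat)%:Z - B%:Z|%N.

(* Each point of the ball has weight [exp(#|I| - |k|_1 / r) >= 1]; the sum of
   the weights over the whole grid factors into geometric series. *)
Lemma card_grid_ball (I : finType) (B : nat) (r : R) : 5%:R / 2%:R <= r ->
  #|[pred f : {ffun I -> 'I_(B + B.+1)} |
      (grid_norm1 f)%:R <= #|I|%:R * r]|%:R <=
  (281%:R / 100%:R * (2%:R * r + 36%:R / 100%:R)) ^+ #|I|.
Proof.
move=> r52; have r0 : 0 < r by lra.
pose x := expR (- r^-1) : R.
have x01 : 0 <= x < 1.
  by rewrite /x expR_ge0 /= expRN invf_lt1 ?expR_gt0 // expR_gt1 invr_gt0.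
have x0 : 0 <= x by have /andP[] := x01.
rewrite -sum1_card natr_sum.
apply: (@le_trans _ _ (\sum_(f : {ffun I -> 'I_(B + B.+1)})
    expR 1 ^+ #|I| * x ^+ grid_norm1 f)).
  rewrite big_mkcond /=; apply: ler_sum => f _; rewrite inE.
  case: ifP => [H|_]; last by rewrite mulr_ge0 // exprn_ge0 ?expR_ge0.
  rewrite /x -!expRM_natl -expRD mulr1.
  apply: le_trans (expR_ge1Dx _); rewrite lerDl mulrN subr_ge0.
  by rewrite -ler_pdivlMr ?invr_gt0 // invrK.
rewrite -mulr_sumr exprMn ler_pM ?exprn_ge0 ?expR_ge0 ?sumr_ge0 //.
- by move=> f _; rewrite exprn_ge0.
- by rewrite lerXn2r ?nnegrE ?expR_ge0 ?expR1_le //; lra.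
rewrite (eq_bigr (fun f : {ffun I -> 'I_(B + B.+1)} =>
  \prod_p x ^+ `|(f p : nat)%:Z - B%:Z|%N)); last first.
  by move=> f _; rewrite -expr_sum.
rewrite -(bigA_distr_bigA (fun (_ : I) (k : 'I_(B + B.+1)) =>
  x ^+ `|(k : nat)%:Z - B%:Z|%N)) prodr_const /=.
apply: lerXn2r; rewrite ?nnegrE; first by apply: sumr_ge0 => f _; rewrite exprn_ge0.
  by lra.
apply: le_trans (two_sided_geometric_le _ x01) _.
apply: le_trans (coth_le _) _; rewrite ?invrK //.
rewrite invr_gt0 r0 /=  -[leRHS]invrK lef_pV2 ?posrE ?invr_gt0; lra.
Qed.

Lemma grid_ord_subproof (B : nat) (k : int) :
  (absz (Num.max (- B%:Z) (Num.min k B%:Z) + B%:Z)%R < B + B.+1)%N.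
Proof. by lia. Qed.

Definition inord_grid (B : nat) (k : int) : 'I_(B + B.+1) :=
  Ordinal (grid_ord_subproof B k).

Lemma inord_gridE (B : nat) (k : int) : (`|k| <= B)%N ->
  ((inord_grid B k : nat)%:Z - B%:Z)%R = k.
Proof. by move=> kB /=; lia. Qed.

(** A unit vector is rounded to the cubic lattice of mesh 2 eps / sqrt N, N = m n, with error at
    most eps. By Cauchy-Schwarz the l1 norm of the integer point is at most sqrt N times its
    Euclidean norm, hence at most N r with r = (1 + eps)/(2 eps), and [card_grid_ball] counts such
    points. *)
Lemma sphere_net m n (eps : R) : 0 < eps <= 1 / 4%:R ->
  exists s : seq 'M[R]_(m, n),
    (size s)%:R <= (281%:R / 100%:R * (1 / eps + 136%:R / 100%:R)) ^+ (m * n) /\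
    forall v : 'M[R]_(m, n), frobenius v = 1 ->
      exists2 g, g \in s & frobenius (v - g) <= eps.
Proof.
move=> /andP[e0 e1]; have [mn0|mn0] := posnP (m * n).
  (* In dimension zero no vector has norm 1, so the empty net works. *)
  exists [::]; split; first by rewrite mn0 expr0 ler01.
  move=> v v1; suff : (1 : R) <= 0 by rewrite ler10.
  rewrite -{1}v1 -[X in _ <= X](mul0r (frobenius v)) -[0](mulr0n 1) -mn0.
  by apply: frob_le_bound => [|i j]; rewrite ?frob_ge0 ?entry_le_frob.
pose N := (m * n)%N; pose sN := Num.sqrt (N%:R : R).
have N0 : 0 < N%:R :> R by rewrite ltr0n.
have sN0 : 0 < sN by rewrite sqrtr_gt0.
have sNN : sN * sN = N%:R by rewrite -expr2 sqr_sqrtr // ltW.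
pose h := 2%:R * eps / sN; have h0 : 0 < h by rewrite divr_gt0 ?mulr_gt0.
pose r := (1 + eps) / (2%:R * eps).
have r52 : 5%:R / 2%:R <= r.
  by rewrite /r ler_pdivlMr ?mulr_gt0 //; nra.
pose B := Num.truncn (N%:R * r).
pose I := ('I_m * 'I_n)%type; pose S := [pred f : {ffun I -> 'I_(B + B.+1)} |
      (grid_norm1 f)%:R <= #|{: I}|%:R * r].
pose pt (f : {ffun I -> 'I_(B + B.+1)}) : 'M[R]_(m, n) :=
  h *: \matrix_(i, j) ((f (i, j) : nat)%:Z - B%:Z)%:~R.
have cI : #|{: I}| = N by rewrite card_prod !card_ord.
exists [seq pt f | f <- enum S]; split.
  rewrite size_map -cardE; apply: le_trans (card_grid_ball _ _ r52) _.
  rewrite cI -/N le_eqVlt; apply/orP; left; apply/eqP.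
  by congr ((_ * _) ^+ _); rewrite /r; field; lra.
move=> v v1.
pose k i j : int := Num.floor (v i j / h + 1 / 2%:R).
have kP i j : `|v i j - h * (k i j)%:~R| <= h / 2%:R.
  have /andP[] := floor_itv (v i j / h + 1 / 2%:R).
  rewrite -/(k i j) intrD; set K := (k i j)%:~R; set V := v i j => k1 k2.
  have -> : V - h * K = h * (V / h - K) by field; lra.
  rewrite normrM gtr0_norm // ler_pM2l // ler_norml; lra.
pose M : 'M[R]_(m, n) := \matrix_(i, j) (k i j)%:~R.
have vM : frobenius (v - h *: M) <= eps.
  rewrite -(ler_pXn2r (n := 2)) // ?nnegrE ?frob_ge0 //; last exact: ltW.
  rewrite frob_sqr (le_trans (@sqnorm_le_bound _ _ _ _ (h / 2%:R) _ _)) //.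
  - by rewrite divr_ge0 // ltW.
  - by move=> i j; rewrite !mxE.
  rewrite -/N -sNN /h; rewrite le_eqVlt; apply/orP; left; apply/eqP; field; lra.
pose a : nat := (\sum_p `|k p.1 p.2|)%N.
have aN : a%:R <= N%:R * r.
  have aE : a%:R = \sum_(p : I) 1 * `|M p.1 p.2|.
    rewrite natr_sum; apply: eq_bigr => p _.
    by rewrite mul1r mxE -intr_norm -natr_absz.
  have a2 : a%:R <= sN * frobenius M.
    rewrite -(ler_pXn2r (n := 2)) // ?nnegrE ?mulr_ge0 ?frob_ge0 //; last exact: ltW.
    rewrite exprMn expr2 [X in _ <= X * _]expr2 sNN -expr2 aE.
    apply: le_trans (cauchy_schwarz _ _) _.
    rewrite frob_sqr sqnorm_pair; apply: ler_pM => //.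
    - by apply: sumr_ge0 => ? _; exact: sqr_ge0.
    - by apply: sumr_ge0 => ? _; exact: sqr_ge0.
    - by under eq_bigr do rewrite expr1n; rewrite sumr_const cI.
    - by apply: ler_sum => p _; rewrite real_normK ?num_real.
  have hM : h * frobenius M <= 1 + eps.
    have := frob_sub_ge (h *: M) v; rewrite frobZ gtr0_norm // v1 frob_distC.
    by lra.
  apply: le_trans a2 _.
  have -> : N%:R * r = sN * ((1 + eps) / h).
    by rewrite -sNN /r /h; field; lra.
  by rewrite ler_pM2l // ler_pdivlMr // mulrC.
have kB i j : (`|k i j| <= B)%N.
  rewrite truncn_ge_nat; last by rewrite mulr_ge0 //; lra.
  apply: le_trans aN; rewrite ler_nat /a (bigD1 (i, j)) //=; exact: leq_addr.
pose f : {ffun I -> 'I_(B + B.+1)} :=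
  [ffun p => inord_grid B (k p.1 p.2)].
have fE p : ((f p : nat)%:Z - B%:Z)%R = k p.1 p.2.
  by rewrite ffunE inord_gridE.
exists (pt f).
  apply: map_f; rewrite mem_enum inE cI; apply: le_trans aN.
  by rewrite ler_nat /grid_norm1 /a; apply: leq_sum => p _; rewrite fE.
suff -> : pt f = h *: M by [].
by congr (_ *: _); apply/matrixP => i j; rewrite !mxE fE.
Qed.

End Nets.

(** * Closure properties of a sigma-algebra given as a collection of sets *)

Section SigmaAlgebra.
Context {T : Type} (G : set (set T)).
Hypothesis sG : sigma_algebra setT G.

Lemma sigmaC A : G A -> G (~` A).
Proof. by case: sG => _ sC _ GA; rewrite -setTD; exact: sC. Qed.

Lemma sigma0 : G set0.
Proof. by case: sG. Qed.

Lemma sigmaT : G setT.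
Proof. by rewrite -setC0; exact/sigmaC/sigma0. Qed.

Lemma sigma_bigcup (I : countType) (D : set I) (F : I -> set T) :
  (forall i, D i -> G (F i)) -> G (\bigcup_(i in D) F i).
Proof.
move=> GF; rewrite bigcup_mkcond.
rewrite (_ : \bigcup_i _ = \bigcup_n
    (if @choice.unpickle I n is Some i then if i \in D then F i else set0 else set0)).
  case: sG => G0 _ sU; apply: sU => n; case: (@choice.unpickle I n) => [i|//].
  by case: ifPn => [/set_mem/GF|_].
apply/seteqP; split => [t [i _ Fit]|t [n _]].
  by exists (choice.pickle i) => //; rewrite choice.pickleK.
by case: (@choice.unpickle I n) => [i|//] Fit; exists i.
Qed.

Lemma sigma_bigcap (I : countType) (D : set I) (F : I -> set T) :
  (forall i, D i -> G (F i)) -> G (\bigcap_(i in D) F i).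
Proof.
move=> GF; rewrite -[X in G X]setCK setC_bigcap; apply/sigmaC/sigma_bigcup.
by move=> i Di; exact/sigmaC/GF.
Qed.

Lemma sigmaU A B : G A -> G B -> G (A `|` B).
Proof.
move=> GA GB; rewrite (_ : _ `|` _ = \bigcup_(b : bool) if b then A else B).
  by apply: sigma_bigcup => -[].
apply/seteqP; split => [t [At|Bt]|t [[] _]]; [by exists true|by exists false|..].
  by left.
by right.
Qed.

Lemma sigmaI A B : G A -> G B -> G (A `&` B).
Proof.
move=> GA GB; rewrite -[X in G X]setCK setCI; apply/sigmaC/sigmaU; exact/sigmaC.
Qed.

End SigmaAlgebra.

(** * Real-valued probabilities, union bounds and countable mixtures *)

Section FiniteMeasure.
Context {R : realType} {d : measure_display} {Omega : measurableType d}.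
Variable P : probability Omega R.

Definition Pr (A : set Omega) : R := fine (P A).

Lemma PrE A : measurable A -> P A = (Pr A)%:E.
Proof. by move=> mA; rewrite /Pr fineK // fin_num_measure. Qed.

Lemma Pr_ge0 A : 0 <= Pr A.
Proof. exact/fine_ge0/measure_ge0. Qed.

Lemma PrT : Pr setT = 1.
Proof. by rewrite /Pr probability_setT. Qed.

Lemma Pr0 : Pr set0 = 0.
Proof. by rewrite /Pr measure0. Qed.

Lemma Pr_le A B : measurable A -> measurable B -> A `<=` B -> Pr A <= Pr B.
Proof.
by move=> mA mB AB; rewrite -lee_fin -!PrE // le_measure // inE.
Qed.

Lemma Pr_splitI A B : measurable A -> measurable B ->
  Pr A = Pr (A `&` B) + Pr (A `&` ~` B).
Proof.
move=> mA mB; apply: EFin_inj.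
rewrite EFinD -!PrE //; try exact: measurableI; last first.
  by apply: measurableI => //; exact: measurableC.
rewrite -measureU //; last 3 first.
- exact: measurableI.
- by apply: measurableI => //; exact: measurableC.
- by rewrite setIACA setICr setI0.
by rewrite -setIUr setUCr setIT.
Qed.

Lemma Pr_leU A B : measurable A -> measurable B ->
  Pr (A `|` B) <= Pr A + Pr B.
Proof.
move=> mA mB; have mU := measurableU _ _ mA mB.
have mUA := measurableI _ _ mU mA.
have mUC := measurableI _ _ mU (measurableC mA).
rewrite (Pr_splitI mU mA); apply: lerD; apply: Pr_le => //.
by move=> o [[Ao|//] nA]; case: (nA Ao).
Qed.

Lemma Pr_le_cover (I : Type) (s : seq I) (A : I -> set Omega) :
  (forall i, measurable (A i)) ->
  measurable (\big[setU/set0]_(i <- s) A i) /\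
  Pr (\big[setU/set0]_(i <- s) A i) <= \sum_(i <- s) Pr (A i).
Proof.
move=> mA; elim: s => [|i s [mU IH]].
  by rewrite !big_nil Pr0; split => //; exact: measurable0.
rewrite !big_cons; split; first exact: measurableU.
by apply: le_trans (Pr_leU (mA i) mU) _; rewrite lerD2l.
Qed.

(* The independence assumption controls [B y] for each fixed [y]; a countable
   range of [Y] replaces Fubini's theorem when [y] is random. *)
Lemma Pr_mix_le (F : set (set Omega)) (I : countType) (Y : Omega -> I)
    (B : I -> set Omega) (c : R) :
  sigma_algebra setT F -> F `<=` measurable -> 0 <= c ->
  (forall y, F [set o | Y o = y]) -> (forall y, measurable (B y)) ->
  (forall y A, F A -> Pr (A `&` B y) <= c * Pr A) ->
  forall A, F A -> Pr (A `&` [set o | B (Y o) o]) <= c * Pr A.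
Proof.
move=> sF Fm c0 FY mB HB A FA.
(* The condition [choice.pickle y = n] keeps one code per value, which makes the sets [C n]
   disjoint. *)
pose C n : set Omega := if @choice.unpickle I n is Some y
  then [set o | Y o = y /\ choice.pickle y = n] else set0.
pose D n : set Omega := if @choice.unpickle I n is Some y then B y else set0.
have FC n : F (C n).
  rewrite /C; case: (@choice.unpickle I n) => [y|]; last exact: sigma0.
  have [/eqP yn|yn] := boolP (choice.pickle y == n); last first.
    rewrite (_ : mkset _ = set0); first exact: sigma0.
    by apply/seteqP; split => // o /= [_ /eqP]; rewrite (negbTE yn).
  rewrite (_ : mkset _ = [set o | Y o = y]); first exact: FY.
  by apply/seteqP; split => o /=; [case|].
have mC n := Fm _ (FC n).
have mD n : measurable (D n).
  by rewrite /D; case: (@choice.unpickle I n).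
have mA := Fm _ FA.
have CY n o : C n o -> n = choice.pickle (Y o).
  by rewrite /C; case: (@choice.unpickle I n) => //= y [-> <-].
have YC o : C (choice.pickle (Y o)) o by rewrite /C choice.pickleK.
have DY o : D (choice.pickle (Y o)) = B (Y o) by rewrite /D choice.pickleK.
have AE : A = \bigcup_n (A `&` C n).
  apply/seteqP; split => [ o Ao|o [n _ [//]]].
  by exists (choice.pickle (Y o)).
have BE : A `&` [set o | B (Y o) o] = \bigcup_n (A `&` C n `&` D n).
  apply/seteqP; split => [ o [Ao Bo]|o [n _ [[Ao /CY ->]]]] /=.
    by exists (choice.pickle (Y o)) => //; rewrite DY.
  by rewrite DY.
have mAC n : measurable (A `&` C n) by exact: measurableI.
have mACD n : measurable (A `&` C n `&` D n) by exact: measurableI.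
have mAB : measurable (A `&` [set o | B (Y o) o]).
  by rewrite BE; apply: bigcupT_measurable.
have tC : trivIset setT (fun n => A `&` C n).
  apply/trivIsetP => i j _ _ ij; apply/seteqP; split => // o [[_ Ci] [_ Cj]].
  by move: ij; rewrite (CY _ _ Ci) (CY _ _ Cj) eqxx.
have tD : trivIset setT (fun n => A `&` C n `&` D n).
  apply/trivIsetP => i j _ _ ij; apply/seteqP; split => // o [[[_ Ci] _] [[_ Cj] _]].
  by move: ij; rewrite (CY _ _ Ci) (CY _ _ Cj) eqxx.
rewrite -lee_fin EFinM -!PrE // BE measure_bigcup //= {2}AE measure_bigcup //.
rewrite -nneseriesZl //; apply: lee_nneseries => // n _.
suff : Pr (A `&` C n `&` D n) <= c * Pr (A `&` C n).
  by rewrite -lee_fin EFinM -(PrE (mACD n)) -(PrE (mAC n)).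
rewrite /D; case: (@choice.unpickle I n) => [y|]; last first.
  by rewrite setI0 Pr0 mulr_ge0 ?Pr_ge0.
by apply: HB; exact: sigmaI.
Qed.

(** * Counting hits along a filtration *)

Section Filtration.
Variable F : nat -> set (set Omega).
Hypothesis sF : forall t, sigma_algebra setT (F t).
Hypothesis Fm : forall t, F t `<=` measurable.
Hypothesis Fmono : forall s t, (s <= t)%N -> F s `<=` F t.

Definition count_hits (H : nat -> set Omega) (j : nat) (o : Omega) : nat :=
  \sum_(i < j) (o \in H i).

(* This is Chernoff's bound for the weight [2^(- count)], which an induction on
   [j] gives without exponential moments. *)
Lemma Pr_count_hits_lt (H : nat -> set Omega) (p : R) : 0 <= p <= 1 ->
  (forall i, F i.+1 (H i)) ->
  (forall i A, F i A -> p * Pr A <= Pr (A `&` H i)) ->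
  forall j n, F j [set o | (count_hits H j o < n)%N] /\
    Pr [set o | (count_hits H j o < n)%N] <= 2%:R ^+ n * (1 - p / 2%:R) ^+ j.
Proof.
move=> /andP[p0 p1] FH HP; elim=> [|j IH] n.
  have -> : [set o | (count_hits H 0 o < n)%N] = if n is 0 then set0 else setT.
    by apply/seteqP; split => o /=; rewrite /count_hits big_ord0; case: n.
  case: n => [|n]; first by rewrite Pr0 !expr0 mulr1 ler01; split=> //; exact: sigma0.
  split; first exact: sigmaT.
  by rewrite PrT expr0 mulr1 exprn_ege1 // ler1n.
case: n => [|n].
  rewrite (_ : mkset _ = set0); last by apply/seteqP; split.
  split; first exact: sigma0.
  by rewrite Pr0 mulr_ge0 ?exprn_ge0 //; lra.
set A := [set o | (count_hits H j o < n.+1)%N].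
set B := [set o | (count_hits H j o < n)%N].
have [FA PA] := IH n.+1; have [FB PB] := IH n.
have BA : B `<=` A by move=> o /=; exact: ltnW.
have E : [set o | (count_hits H j.+1 o < n.+1)%N] =
    (A `&` ~` H j) `|` (B `&` H j).
  apply/seteqP; split => o; rewrite /= /count_hits big_ord_recr /=.
    have [oH|oH] := boolP (o \in H j); rewrite ?addn1 ?addn0.
      by rewrite ltnS => ?; right; split => //; exact/set_mem.
    by move=> ?; left; split => // /mem_set; apply/negP.
  move=> [[Ao Ho]|[Bo Ho]].
    by rewrite memNset //= addn0.
  by rewrite mem_set //= addn1 ltnS.
have FHj := FH j; have FjA := Fmono (leqnSn j) FA; have FjB := Fmono (leqnSn j) FB.
have mH := Fm FHj; have mA := Fm FA; have mB := Fm FB.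
split.
  by rewrite E; apply: sigmaU; rewrite ?sF //; apply: sigmaI => //; exact: sigmaC.
have mAH : measurable (A `&` ~` H j) by apply: measurableI => //; exact: measurableC.
have mBH : measurable (B `&` H j) by exact: measurableI.
have mE := measurableU _ _ mAH mBH.
rewrite E (Pr_splitI mE mH).
have L1 : Pr ((A `&` ~` H j `|` B `&` H j) `&` H j) <= Pr (B `&` H j).
  by apply: Pr_le => //; [exact: measurableI | move=> o [[[_ nH]|//] Ho]; case: (nH Ho)].
have L2 : Pr ((A `&` ~` H j `|` B `&` H j) `&` ~` H j) <= Pr (A `&` ~` H j).
  apply: Pr_le => //; first by apply: measurableI => //; exact: measurableC.
  by move=> o [[//|[_ Ho]] nH]; case: (nH Ho).
(* [A] minus [B] is the event of exactly [n] hits so far. The hypothesis on it bounds the new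
   probability by (1 - p) Pr A + p Pr B, and the two induction bounds combine since (1 - p) + p/2 =
   1 - p/2. *)
have FAB : F j (A `&` ~` B) by apply: sigmaI => //; exact: sigmaC.
have := HP _ _ FAB.
have S1 := Pr_splitI mA mB; rewrite (setIidr BA) in S1.
have S2 := Pr_splitI mA mH.
have S3 : Pr (A `&` H j) = Pr (B `&` H j) + Pr (A `&` ~` B `&` H j).
  rewrite (Pr_splitI (measurableI _ _ mA mH) mB); congr (Pr _ + Pr _).
    by rewrite setIAC (setIidr BA).
  by rewrite setIAC.
move=> L3; have c0 : 0 <= (1 - p / 2%:R) ^+ j :> R by rewrite exprn_ge0 //; lra.
move: PA PB; rewrite -/A -/B (exprS 2%:R n) exprS; set X := 2%:R ^+ n; set c := (_ ^+ j).
move=> PA PB.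
have : (1 - p) * Pr A <= (1 - p) * (2%:R * X * c) by rewrite ler_wpM2l //; lra.
have : p * Pr B <= p * (X * c) by rewrite ler_wpM2l //; lra.
nra.
Qed.

(** * Bad events at the first hit of each block *)

Section Blocks.
Variables (Hit Bad : nat -> set Omega) (c : R).
Hypothesis c0 : 0 <= c.
Hypothesis FHit : forall s, F s (Hit s).
Hypothesis FBad : forall s, F s.+1 (Bad s).
Hypothesis PBad : forall s A, F s A -> Pr (A `&` Bad s) <= c * Pr A.

(** Only the first hit counts: whether it occurs at time [s + j] is known in [F (s + j)], while the
    bad event there is known one step later. *)
Definition first_hit_bad (s m : nat) : set Omega :=
  [set o | exists j, [/\ (j < m)%N, Hit (s + j)%N o,
     (forall i, (i < j)%N -> ~ Hit (s + i)%N o) & Bad (s + j)%N o]].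

(** The value of the first hit time splits the event into disjoint pieces; each costs a factor [c]
    given its past, and these pasts are disjoint parts of [A]. *)
Lemma Pr_first_hit_bad s m A : F s A ->
  F (s + m)%N (first_hit_bad s m) /\ Pr (A `&` first_hit_bad s m) <= c * Pr A.
Proof.
move=> FA.
pose V j := [set o | exists2 i, (i < j)%N & Hit (s + i)%N o].
(* The bound is strengthened from [A] to [A] with a hit before [s + j], so that the induction can
   add the mass of a new first hit. *)
suff H j : [/\ F (s + j)%N (first_hit_bad s j), F (s + j)%N (V j) &
    Pr (A `&` first_hit_bad s j) <= c * Pr (A `&` V j)].
  have [H1 H2 H3] := H m; split => //; apply: le_trans H3 _.
  have mA := Fm FA; have mAV := measurableI _ _ mA (Fm H2).
  by rewrite ler_wpM2l // Pr_le // => o [].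
elim: j => [|j [IH1 IH2 IH3]].
  have -> : first_hit_bad s 0 = set0 by apply/seteqP; split => // o [? []].
  have -> : V 0 = set0 by apply/seteqP; split => // o [].
  by rewrite !setI0 Pr0 mulr0; split => //; exact: sigma0.
pose Fst := Hit (s + j)%N `&` ~` V j.
have FFst : F (s + j)%N Fst by apply: sigmaI => //; exact: sigmaC.
have E1 : first_hit_bad s j.+1 = first_hit_bad s j `|` (Fst `&` Bad (s + j)%N).
  apply/seteqP; split => o.
    move=> [i [ij Hi nH Bi]]; move: ij; rewrite ltnS leq_eqVlt => /orP[/eqP ij|ij].
      subst i; right; split => //; split => // -[i ij Hit_i]; exact: (nH i ij).
    by left; exists i; split.
  move=> [[i [ij Hi nH Bi]]|[[Hj nV] Bj]].
    by exists i; split => //; exact: leq_trans ij _.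
  by exists j; split => // i ij Hi; apply: nV; exists i.
have E2 : V j.+1 = V j `|` Hit (s + j)%N.
  apply/seteqP; split => o.
    move=> [i]; rewrite ltnS leq_eqVlt => /orP[/eqP -> ?|ij Hi]; first by right.
    by left; exists i.
  move=> [[i ij Hi]|Hj]; last by exists j.
  by exists i => //; exact: leq_trans ij _.
have S : F (s + j)%N `<=` F (s + j.+1)%N by apply: Fmono; rewrite leq_add2l.
have FB : F (s + j.+1)%N (Fst `&` Bad (s + j)%N).
  by apply: sigmaI => //; [exact: S | rewrite addnS].
have FAj : F (s + j)%N A by apply: Fmono FA; exact: leq_addr.
split; [by rewrite E1; apply: sigmaU => //; exact: S|
  by rewrite E2; apply: sigmaU => //; exact: S|].
have mA := Fm FA; have mV := Fm IH2; have mFst := Fm FFst; have mB := Fm FB.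
have mV1 : measurable (V j.+1).
  by rewrite E2; apply: measurableU => //; exact: Fm (FHit _).
have m1 := Fm IH1.
have -> : Pr (A `&` V j.+1) = Pr (A `&` V j) + Pr (A `&` Fst).
  rewrite (Pr_splitI (measurableI _ _ mA mV1) mV); congr (Pr _ + Pr _).
    by rewrite -setIA E2; congr (_ `&` _); rewrite setIidr //; exact: subsetUl.
  by rewrite -setIA E2 setIUl setICr set0U.
rewrite mulrDr; apply: (le_trans _ (lerD IH3 (PBad (sigmaI (sF _) FAj FFst)))).
have mI1 := measurableI _ _ mA m1.
have mI2 : measurable (A `&` Fst `&` Bad (s + j)%N).
  by rewrite -(setIA A); exact: measurableI.
apply: (le_trans _ (Pr_leU mI1 mI2)); rewrite E1 setIUr (setIA A).
by apply: Pr_le => //; exact: measurableU.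
Qed.

(** The events of the first [K] blocks are known at time [K * m + 1], when the next block starts, so
    the conditional bounds multiply. *)
Lemma Pr_all_blocks m K :
  F (K * m).+1 [set o | forall k, (k < K)%N -> first_hit_bad (k * m).+1 m o] /\
  Pr [set o | forall k, (k < K)%N -> first_hit_bad (k * m).+1 m o] <= c ^+ K.
Proof.
elim: K => [|K [IH1 IH2]].
  rewrite (_ : mkset _ = setT); last by apply/seteqP; split.
  by rewrite PrT expr0; split => //; exact: sigmaT.
rewrite (_ : mkset _ = [set o | forall k, (k < K)%N ->
  first_hit_bad (k * m).+1 m o] `&` first_hit_bad (K * m).+1 m); last first.
  apply/seteqP; split => o /=.
    by move=> H; split => [k kK|]; apply: H => //; exact: ltnW.
  move=> [H HK] k; rewrite ltnS leq_eqVlt => /orP[/eqP ->//|]; exact: H.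
have [H1 H2] := Pr_first_hit_bad m IH1.
split; last by apply: le_trans H2 _; rewrite exprS ler_wpM2l.
rewrite addSn addnC -mulSn in H1; apply: sigmaI => //.
by apply: Fmono IH1; rewrite ltnS leq_mul2r leqnSn orbT.
Qed.

End Blocks.
End Filtration.
End FiniteMeasure.

(** * Borel measurability of continuous functions *)

Section Borel.
Context {R : realType} {n : nat}.

Lemma borel_open (U : set 'cV[R]_n) : open U -> measurable (U : set (borelV R n)).
Proof. by move=> oU; exact: sub_sigma_algebra. Qed.

Lemma borel_continuous (g : 'cV[R]_n -> R) :
  continuous g -> measurable_fun setT (g : borelV R n -> R).
Proof.
move=> cg; apply: (measurability _ (measurable_realfun.RGenOpens.measurableE R)).
move=> _ [_ [a [b ->]] <-]; rewrite setTI; apply: borel_open.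
by apply: open_comp => [x _|]; [exact: cg | exact: interval_open].
Qed.

End Borel.

(** * The filtration, the small-ball condition and the boundary-visiting noise *)

Section RandomVectors.
Context {R : realType} {d : measure_display} {Omega : measurableType d}.

Lemma sigma_rv_preimage n (X : Omega -> 'cV[R]_n) (B : set 'cV[R]_n) :
  measurable (B : set (borelV R n)) -> sigma_rv X (X @^-1` B).
Proof. by move=> mB; exists B => //; rewrite setTI. Qed.

Lemma sigma_rv_measurable n (X : Omega -> 'cV[R]_n) :
  random_vector X -> sigma_rv X `<=` measurable.
Proof. by move=> mX _ [B mB <-]; exact: mX. Qed.

Lemma sigma_rv_ge n (X : Omega -> 'cV[R]_n) (g : 'cV[R]_n -> R) a :
  continuous g -> sigma_rv X [set o | a <= g (X o)].
Proof.
move=> cg; apply: (@sigma_rv_preimage _ X [set v | a <= g v]).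
rewrite (_ : mkset _ = g @^-1` `[a, +oo[); last first.
  by apply/seteqP; split => v; rewrite /= in_itv /= andbT.
by rewrite -[X in measurable X]setTI; apply: (borel_continuous cg).
Qed.

Context {nx nz : nat}.
Variables (w : nat -> Omega -> 'cV[R]_nx) (z : nat -> Omega -> 'cV[R]_nz).
Hypothesis mw : forall t, random_vector (w t).
Hypothesis mz : forall t, random_vector (z t).

Lemma filtration_sigma t : sigma_algebra setT (filtration w z t).
Proof. exact: smallest_sigma_algebra. Qed.

Lemma filtration_measurable t : filtration w z t `<=` measurable.
Proof.
apply: smallest_sub; first exact: sigma_algebra_measurable.
by move=> A [[k _]|[k _]]; exact: sigma_rv_measurable.
Qed.

Lemma filtration_mono s t :
  (s <= t)%N -> filtration w z s `<=` filtration w z t.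
Proof.
move=> st; apply: sub_sigma_algebra2 => A [[k ks Ak]|[k ks Ak]].
  by left; exists k => //=; exact: leq_trans ks st.
by right; exists k => //=; exact: leq_trans ks _.
Qed.

Lemma filtration_z s t : (s <= t)%N -> sigma_rv (z s) `<=` filtration w z t.
Proof. by move=> st A zA; apply: sub_sigma_algebra; right; exists s. Qed.

Lemma filtration_w s t : (s < t)%N -> sigma_rv (w s) `<=` filtration w z t.
Proof. by move=> st A wA; apply: sub_sigma_algebra; left; exists s. Qed.

Variable P : probability Omega R.

Lemma continuous_dotv n (l : 'cV[R]_n) : continuous (dotv l).
Proof.
move=> v; rewrite (_ : dotv l = fun v => \sum_i l i 0 * v i 0); last first.
  by apply/funext => u; rewrite dotvE.
apply: continuous_big => [|i _]; first exact: add_continuous.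
move=> u; exact: (continuous_comp (@coord_continuous R n 1 i 0 u)
  (@mulrl_continuous R (l i 0) _)).
Qed.

Lemma sigma_rv_dotv_ge n (X : Omega -> 'cV[R]_n) (l : 'cV[R]_n) a :
  sigma_rv X [set o | a <= `|dotv l (X o)|].
Proof.
apply: (@sigma_rv_ge _ _ (fun v => `|dotv l v|)) => v.
apply: (@continuous_comp _ _ _ (dotv l) (fun x : R => `|x|)).
  exact: continuous_dotv.
exact: norm_continuous.
Qed.

(** Integrating the version [g] of the conditional probability over [A] turns the condition into an
    inequality on past events; homogeneity extends it from unit vectors to all [l], and for [l = 0]
    the event is everything. *)
Lemma bmsb_le (sigma p : R) : 0 <= p <= 1 -> bmsb P w z sigma p ->
  forall (l : 'cV[R]_nz) t A, (1 <= t)%N -> filtration w z t A ->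
  p * Pr P A <=
    Pr P (A `&` [set o | sigma * frobenius l <= `|dotv l (z t.+1 o)|]).
Proof.
move=> /andP[p0 p1] H l t A t1 FA.
have mA := filtration_measurable FA.
have [->|l0] := eqVneq l 0.
  rewrite (_ : _ `&` _ = A); first by rewrite ler_piMl // Pr_ge0.
  apply/setIidl => o _ /=.
  by rewrite frob0 mulr0.
have fl := frob_gt0 l0.
pose l' := (frobenius l)^-1 *: l.
have l'1 : frobenius l' = 1.
  by rewrite frobZ gtr0_norm ?invr_gt0 // mulVf // gt_eqF.
rewrite (_ : [set o | _] = [set o | sigma <= `|dotv l' (z t.+1 o)|]); last first.
  apply/seteqP; split => o /=; rewrite dotvZl normrM gtr0_norm ?invr_gt0 //;
  by rewrite ler_pdivlMl // mulrC.
have [g [[gF gint gA] gp]] := H l' l'1 t t1.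
set E := [set o | sigma <= `|_|] in gA *.
have mE : measurable E.
  apply: (sigma_rv_measurable (mz t.+1)); exact: sigma_rv_dotv_ge.
(* As [g] is at least [p] only almost surely, [A] is cut down to the set where this holds, at no
   loss of mass. *)
pose A' := A `&` g @^-1` `[p, +oo[.
have FA' : filtration w z t A'.
  by apply: (sigmaI (filtration_sigma t)) => //; exact: (gF _ (measurable_itv _)).
have mA' := filtration_measurable FA'.
have -> : Pr P A = Pr P A'.
  rewrite (Pr_splitI P mA (filtration_measurable (gF _ (measurable_itv `[p, +oo[)))).
  rewrite -/A' -[RHS]addr0; congr (_ + _).
  have mG := measurableC (filtration_measurable (gF _ (measurable_itv `[p, +oo[))).
  apply/eqP; rewrite eq_le Pr_ge0 andbT.
  case: gp => N [mN PN NG].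
  apply: (@le_trans _ _ (Pr P N)); last by rewrite /Pr PN.
  apply: Pr_le => //; first exact: measurableI.
  move=> o [_ gpo]; apply: NG => /= pg; apply: gpo; rewrite /= in_itv /= andbT //.
have mAE := measurableI _ _ mA mE; have mAE' := measurableI _ _ mA' mE.
apply: (@le_trans _ _ (Pr P (A' `&` E))); last first.
  by apply: Pr_le => //; apply: setSI => o [].
rewrite -lee_fin EFinM -(PrE P mAE') -(PrE P mA') setIC -gA //.
rewrite -integral_cst //; apply: ge0_le_integral => //.
- by have := measurable_int _ gint; exact: measurable_funS.
- by move=> o [_ /=]; rewrite in_itv /= andbT lee_fin.
Qed.

(** The noise at time [s] is independent of the past, so conditioning on [A] leaves the chance of
    staying away from a fixed boundary point unchanged. *)
Lemma noise_away_le (W : set 'cV[R]_nx) (q : R -> R) (eta : R) :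
  nonanticipative P w z -> boundary_visiting P W w q -> 0 < eta ->
  forall s (w0 : 'cV[R]_nx) A, boundary W w0 -> filtration w z s A ->
  sigma_rv (w s) [set o | eta <= frobenius (w0 - w s o)] /\
  Pr P (A `&` [set o | eta <= frobenius (w0 - w s o)]) <= (1 - q eta) * Pr P A.
Proof.
move=> na bv eta0 s w0 A bw0 FA.
have sB : sigma_rv (w s) [set o | eta <= frobenius (w0 - w s o)].
  apply: (@sigma_rv_ge _ _ (fun v => frobenius (w0 - v))) => v.
  have cB : {for v, continuous (fun u : 'cV[R]_nx => w0 - u)}.
    by apply: continuousB; [exact: cst_continuous | exact: cvg_id].
  exact: (continuous_comp cB (@continuous_frob R nx 1 _)).
split => //; set B := mkset _ in sB *.
have mB := sigma_rv_measurable (@mw s) sB; have mA := filtration_measurable FA.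
have [_ /(_ s w0 bw0) H] := bv _ eta0.
have BC : [set o | frobenius (w0 - w s o) < eta] = ~` B.
  by apply/seteqP; split => o /=; rewrite ltNge => /negP.
move: H; rewrite BC (PrE P (measurableC mB)) lee_fin => H.
have B1 : Pr P B <= 1 - q eta.
  have := Pr_splitI P measurableT mB; rewrite PrT !setTI; lra.
have := na s B A sB FA; rewrite setIC (PrE P (measurableI _ _ mA mB)).
rewrite (PrE P mA) (PrE P mB) -EFinM => -[->].
by rewrite ler_wpM2r // Pr_ge0.
Qed.

End RandomVectors.

(** * Extremal boundary points and excitation within a block *)

Section Geometry.
Context {R : realType}.

(** A linear form attains its maximum on a compact set, and for [v != 0] not at an interior point,
    since a small step along [v] increases it. *)
Lemma support_boundary_point n (W : set 'cV[R]_n) (v : 'cV[R]_n) : (0 < n)%N ->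
  compact W -> W !=set0 ->
  exists w0, boundary W w0 /\ forall y, W y -> dotv v y <= dotv v w0.
Proof.
move=> n0 cW W0.
suff {v} H (v : 'cV[R]_n) : v != 0 ->
    exists w0, boundary W w0 /\ forall y, W y -> dotv v y <= dotv v w0.
  (* For [v = 0] any boundary point will do; the all-ones direction provides one because [n] is
     positive. *)
  have [->|] := eqVneq v 0; last exact: H.
  have [|w0 [bw0 _]] := H (const_mx 1).
    apply/eqP => /matrixP /(_ (Ordinal n0) 0); rewrite !mxE; apply/eqP.
    exact: oner_neq0.
  by exists w0; split => // y _; rewrite -(scale0r 0) !dotvZl !mul0r.
move=> v0; have cd : {within W, continuous (dotv v)}.
  by apply: continuous_subspaceT; exact: continuous_dotv.
have [c /set_mem Wc cmax] := compact_EVT_max W0 cW cd.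
exists c; split; last by move=> y Wy; apply: cmax; exact/mem_set.
split; first exact: subset_closure.
move=> /nbhs_ballP[e /= e0 He].
pose t := e / (2%:R * (1 + `|v|)).
have nv : 0 < 1 + `|v| by rewrite ltr_wpDr.
have t0 : 0 < t by rewrite divr_gt0 ?mulr_gt0.
have Wt : W (c + t *: v).
  apply: He; rewrite -ball_normE /= opprD addrA subrr sub0r normrN normrZ.
  rewrite gtr0_norm // /t mulrAC ltr_pdivrMr ?mulr_gt0 //.
  by rewrite ltr_pM2l //; have := normr_ge0 v; lra.
have := cmax _ (mem_set Wt); rewrite dotvDr dotvZr dotvv.
have : 0 < t * frobenius v ^+ 2 by rewrite mulr_gt0 // exprn_gt0 // frob_gt0.
by lra.
Qed.

(** A net point near a unit vector has norm at least 19/20, and replacing one by the other changes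
    the product with [z j] by at most sig p/20. So a hit of the net point at level sig times its
    norm is a hit of the unit vector at level (19/20 - 1/20) sig = 9/10 sig. *)
Lemma energy_of_hits (nz M n : nat) (z : nat -> 'cV[R]_nz) (s : seq 'cV[R]_nz)
    (sig p bz : R) :
  0 < p <= 1 -> 0 < sig <= bz ->
  (forall l : 'cV[R]_nz, frobenius l = 1 ->
     exists2 g, g \in s & frobenius (l - g) <= sig * p / (20%:R * bz)) ->
  (forall j, (j < M)%N -> frobenius (z j) <= bz) ->
  (forall g, g \in s ->
    (n <= \sum_(j < M) (sig * frobenius g <= `|dotv g (z j)|)%R)%N) ->
  forall l : 'cV[R]_nz, n%:R * ((9%:R / 10%:R * sig) ^+ 2 * frobenius l ^+ 2) <=
    \sum_(j < M) dotv l (z j) ^+ 2.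
Proof.
move=> /andP[p0 p1] /andP[s0 sb] net zb hits l.
have b0 : 0 < bz by exact: lt_le_trans sb.
have [->|l0] := eqVneq l 0.
  rewrite frob0 expr0n !mulr0.
  by apply: sumr_ge0 => j _; exact: sqr_ge0.
have fl := frob_gt0 l0.
pose l' := (frobenius l)^-1 *: l.
have l'1 : frobenius l' = 1.
  by rewrite frobZ gtr0_norm ?invr_gt0 // mulVf // gt_eqF.
have lE : l = frobenius l *: l' by rewrite scalerA mulfV ?scale1r // gt_eqF.
have [g gs lg] := net _ l'1.
have E20 : sig * p / (20%:R * bz) * bz = sig * p / 20%:R by field; lra.
set e := sig * p / (20%:R * bz) in lg E20.
have e1 : e <= 1 / 20%:R by rewrite /e ler_pdivrMr ?mulr_gt0 //; nra.
have fg : 19%:R / 20%:R <= frobenius g.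
  by have := frob_sub_ge l' g; rewrite l'1; lra.
have H j : (j < M)%N -> sig * frobenius g <= `|dotv g (z j)| ->
    (9%:R / 10%:R * sig) ^+ 2 * frobenius l ^+ 2 <= dotv l (z j) ^+ 2.
  move=> jM hj; have zj := zb j jM.
  have D : `|dotv g (z j)| <= `|dotv l' (z j)| + sig * p / 20%:R.
    have -> : dotv g (z j) = dotv l' (z j) - dotv (l' - g) (z j).
      by rewrite dotvBl opprB addrC subrK.
    apply: le_trans (ler_normB _ _) _; rewrite lerD2l -E20.
    apply: le_trans (dotv_le _ _) _.
    by rewrite ler_pM ?frob_ge0.
  have D2 : 9%:R / 10%:R * sig <= `|dotv l' (z j)| by nra.
  rewrite [in leRHS]lE dotvZl [in leRHS]exprMn [leRHS]mulrC ler_wpM2r ?sqr_ge0 //.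
  rewrite -[leRHS]real_normK ?num_real // lerXn2r ?nnegrE //; lra.
have hg := hits _ gs.
apply: (@le_trans _ _ (\sum_(j < M)
  (sig * frobenius g <= `|dotv g (z j)|)%R%:R *
   ((9%:R / 10%:R * sig) ^+ 2 * frobenius l ^+ 2))).
  rewrite -mulr_suml ler_wpM2r //.
    by apply: mulr_ge0; exact: sqr_ge0.
  by rewrite -(ler_nat R n) natr_sum in hg.
apply: ler_sum => j _; have [hj|_] := boolP (sig * frobenius g <= _).
  by rewrite mul1r; exact: H.
by rewrite mul0r sqr_ge0.
Qed.

(** Summing the energy over the rows of [ga] gives at least (p m/2)(0.81 sig^2) = 0.405 p m sig^2.
    If every [ga *m z j] were below 0.63 sig p, it would be at most 0.3969 p^2 m sig^2, which is
    smaller. *)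
Lemma excitation (nx nz M m n : nat) (z : nat -> 'cV[R]_nz) (s : seq 'cV[R]_nz)
    (sig p bz : R) :
  0 < p <= 1 -> 0 < sig <= bz ->
  (forall l : 'cV[R]_nz, frobenius l = 1 ->
     exists2 g, g \in s & frobenius (l - g) <= sig * p / (20%:R * bz)) ->
  (forall j, (j < M)%N -> frobenius (z j) <= bz) ->
  (forall g, g \in s ->
    (n <= \sum_(j < M) (sig * frobenius g <= `|dotv g (z j)|)%R)%N) ->
  (M <= m)%N -> (0 < m)%N -> p * m%:R / 2%:R <= n%:R ->
  forall ga : 'M[R]_(nx, nz), frobenius ga = 1 ->
  exists2 j, (j < M)%N & 63%:R / 100%:R * (sig * p) <= frobenius (ga *m z j).
Proof.
move=> p01 sb net zb hits Mm m0 pn ga ga1.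
have En := energy_of_hits p01 sb net zb hits.
move/andP: p01 => [p0 p1]; move/andP: sb => [s0 sb].
apply: contrapT => nex.
have U : \sum_(j < M) sqnorm (ga *m z j) <=
    m%:R * (63%:R / 100%:R * (sig * p)) ^+ 2.
  apply: (@le_trans _ _ (\sum_(j < M) (63%:R / 100%:R * (sig * p)) ^+ 2)).
    apply: ler_sum => j _; rewrite -frob_sqr lerXn2r ?nnegrE ?frob_ge0 //.
      by rewrite !mulr_ge0 // ltW.
    rewrite leNgt; apply/negP => H; apply: nex; exists j => //; exact: ltW.
  by rewrite sumr_const card_ord -[leLHS]mulr_natl ler_wpM2r ?sqr_ge0 // ler_nat.
have L : n%:R * (9%:R / 10%:R * sig) ^+ 2 <= \sum_(j < M) sqnorm (ga *m z j).
  have {1}-> : n%:R * (9%:R / 10%:R * sig) ^+ 2 =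
      n%:R * (9%:R / 10%:R * sig) ^+ 2 * sqnorm ga.
    by rewrite -frob_sqr ga1 expr1n mulr1.
  rewrite sqnorm_rows.
  under [leRHS]eq_bigr do rewrite sqnorm_mulmxE.
  rewrite [leRHS]exchange_big /= mulr_sumr; apply: ler_sum => i _.
  by rewrite -(mulrA n%:R); exact: En.
have := le_trans L U.
have m0' : 1 <= m%:R :> R by rewrite ler1n.
have : p * m%:R / 2%:R * (9%:R / 10%:R * sig) ^+ 2 <=
    n%:R * (9%:R / 10%:R * sig) ^+ 2 by rewrite ler_wpM2r ?sqr_ge0.
have mpp : m%:R * p ^+ 2 <= m%:R * p by rewrite ler_wpM2l //; nra.
have sp : m%:R * p ^+ 2 * sig ^+ 2 <= m%:R * p * sig ^+ 2.
  by rewrite ler_wpM2r ?sqr_ge0.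
have : 0 < m%:R * p * sig ^+ 2 by rewrite !mulr_gt0 ?exprn_gt0 //; lra.
by nra.
Qed.

Lemma approx_mulmx (m n : nat) (A B : 'M[R]_(m, n)) (u v : 'cV[R]_n) e t b :
  0 <= e -> frobenius A = 1 -> frobenius (A - B) <= e -> frobenius (u - v) <= t ->
  frobenius u <= b -> frobenius (A *m u - B *m v) <= t + e * (b + t).
Proof.
move=> e0 A1 AB uv ub.
have -> : A *m u - B *m v = A *m (u - v) + (A - B) *m v.
  by rewrite mulmxBr mulmxBl addrA subrK.
apply: le_trans (frob_triangle _ _) _; apply: lerD.
  by apply: le_trans (frob_mulmx _ _) _; rewrite A1 mul1r.
apply: le_trans (frob_mulmx _ _) _; apply: ler_pM; rewrite ?frob_ge0 //.
have := frob_sub_ge v u; rewrite frob_distC; lra.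
Qed.

(** Since [w - g] is in [W], extremality of [w0] gives <v, g> <= <v, w - w0>; Cauchy-Schwarz does
    the rest. *)
Lemma noise_away_of_member (n : nat) (W : set 'cV[R]_n) (v g w w0 : 'cV[R]_n)
    (eta : R) :
  v != 0 -> (forall y, W y -> dotv (- v) y <= dotv (- v) w0) ->
  eta * frobenius v <= dotv v g -> W (w - g) -> eta <= frobenius (w0 - w).
Proof.
move=> v0 w0max vg /w0max; rewrite dotvBr !dotvNl => H.
have fv := frob_gt0 v0.
rewrite -(ler_pM2r fv); apply: le_trans vg _; rewrite mulrC.
rewrite frob_distC; apply: le_trans (dotv_le _ _); apply: le_trans (ler_norm _).
by rewrite dotvBr; lra.
Qed.

End Geometry.

(** * Measurability of the event that the diameter is large *)

Section Measurability.
Context {R : realType}.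

(** An open set is the union of the max-norm balls inside it with rational centre and radius 1/(k +
    1); membership in such a ball is a finite conjunction of conditions on entries. *)
Lemma preimage_open_measurable (d : measure_display) (Omega : measurableType d)
    m n (f : Omega -> 'M[R]_(m, n)) :
  (forall i j, measurable_fun setT (fun o => f o i j)) ->
  forall U, open U -> measurable (f @^-1` U).
Proof.
move=> mf U oU.
have sM := @sigma_algebra_measurable d Omega.
pose D := [set qk : 'M[rat]_(m, n) * nat |
  ball (map_mx ratr qk.1 : 'M[R]_(m, n)) qk.2.+1%:R^-1 `<=` U].
rewrite (_ : f @^-1` U = \bigcup_(qk in D) \bigcap_(ij : 'I_m * 'I_n)
  [set o | `|ratr (qk.1 ij.1 ij.2) - f o ij.1 ij.2| < qk.2.+1%:R^-1]).
  apply: (sigma_bigcup sM) => -[q k] _; apply: (sigma_bigcap sM) => -[i j] _ /=.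
  set r : R := ratr _; set e : R := k.+1%:R^-1.
  rewrite (_ : mkset _ = (fun o => f o i j) @^-1` `]r - e, r + e[).
    rewrite -[X in measurable X]setTI; apply: mf => //; exact: measurable_itv.
  apply/seteqP; split => o; rewrite /= in_itv /= ltr_norml => /andP[H1 H2];
  by apply/andP; split; lra.
apply/seteqP; split => [ o Uf|o [[q k] /= qkU] H]; last first.
  apply: qkU; split=> [|i j]; first by rewrite invr_gt0 ltr0n.
  by rewrite mxE; exact: (H (i, j)).
have /nbhs_ballP[e /= e0 He] : nbhs (f o) U by exact: open_nbhs_nbhs.
pose k := Num.truncn (2%:R / e).
have k0 : 0 < k.+1%:R^-1 :> R by rewrite invr_gt0.
have ke : k.+1%:R^-1 < e / 2%:R.
  rewrite -[ltRHS]invrK ltf_pV2 ?posrE ?invr_gt0 ?divr_gt0 //.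
  by rewrite invf_div truncnS_gt.
have Q i j : exists q : rat, `|ratr q - f o i j| < k.+1%:R^-1.
  move: (f o i j) k0 => y; move: (_^-1) => c c0.
  have [|q] := @rat_in_itvoo R (y - c) (y + c); first by lra.
  rewrite in_itv /= => /andP[? ?]; exists q.
  by rewrite ltr_distlC; apply/andP; split; lra.
exists (\matrix_(i, j) projT1 (cid (Q i j)), k); last first.
  by move=> [i j] _ /=; rewrite mxE; exact: projT2 (cid (Q i j)).
move=> M /= [_ HM]; apply: He; split => // i j.
have := HM i j; rewrite /ball /= !mxE => H1.
have := projT2 (cid (Q i j)) => H2.
set q := ratr _ in H1 H2.
rewrite distrC in H2.
have -> : f o i j - M i j = (f o i j - q) + (q - M i j) by lra.
apply: le_lt_trans (ler_normD _ _) _; apply: lt_trans (ltrD H2 H1) _.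
by rewrite [ltRHS](splitr e) ltrD.
Qed.

(** The tube lemma: if no [v] in [K] is paired with [x], compactness gives a whole neighbourhood of
    [x] with that property. *)
Lemma closed_exists_compact (X V : topologicalType) (K : set V) (S : set (X * V)) :
  compact K -> closed S -> closed [set x | exists2 v, K v & S (x, v)].
Proof.
move=> /compact_near_coveringP cK cS; rewrite -[X in closed X]setCK.
apply: open_closedC; rewrite openE => x nx.
have /(_ _) H := cK X (nbhs x) (fun x v => ~ S (x, v)) _.
have : \forall x' \near x, K `<=` (fun v => ~ S (x', v)).
  apply: H => v Kv.
  have : nbhs (x, v) (~` S).
    apply: open_nbhs_nbhs; split; first exact: closed_openC.
    by move=> Sxv; apply: nx; exists v.
  move=> [[A B] /= [nA nB] AB].
  by exists (B, A) => //= -[v' x'] [Bv Ax]; apply: AB.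
by apply: filterS => x' H' [v Kv]; exact: H'.
Qed.

Lemma compact_box m n (k : R) :
  compact [set M : 'M[R]_(m, n) | forall i j, M i j \in `[- k, k]].
Proof.
rewrite (_ : mkset _ = vec_mx @`
    [set v : 'rV[R]_(m * n) | forall i, `[- k, k]%classic (v ord0 i)]).
  apply: continuous_compact; last first.
    by apply: (@rV_compact _ _ (fun=> `[- k, k]%classic)) => i; exact: segment_compact.
  apply: continuous_subspaceT; apply: continuous_mx => i j v.
  rewrite (_ : (fun x => _) = (fun v : 'rV[R]_(m * n) => v ord0 (mxvec_index i j))).
    exact: coord_continuous.
  by apply/funext => u; rewrite mxE.
apply/seteqP; split => [M HM|_ [v Hv <-] i j]; last by rewrite mxE; exact: Hv.
exists (mxvec M); last exact: mxvecK.
by move=> k'; case/mxvec_indexP: k' => i j; rewrite /= mxvecE; exact: HM.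
Qed.

Lemma continuous_mulmx (X : topologicalType) m n p (f : X -> 'M[R]_(m, n))
    (g : X -> 'M[R]_(n, p)) :
  continuous f -> continuous g -> continuous (fun x => f x *m g x).
Proof.
move=> cf cg; apply: continuous_mx => i j.
rewrite (_ : (fun x => _) = fun x => \sum_k f x i k * g x k j); last first.
  by apply/funext => x; rewrite mxE.
apply: continuous_big => [|k _ x]; first exact: add_continuous.
apply: (@continuousM _ _ (fun x => f x i k) (fun x => g x k j)).
  exact: (continuous_comp (cf x) (@coord_continuous R m n i k _)).
exact: (continuous_comp (cg x) (@coord_continuous R n p k j _)).
Qed.

(* [P] has no meaning on non-measurable sets, and the event quantifies over an
   uncountable set of parameters: it is a countable union of preimages of
   projections of closed sets along compact sets. *)
Lemma diam_gt_measurable (d : measure_display) (Omega : measurableType d)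
    (nx nu T : nat) (W : set 'cV[R]_nx) (x : nat -> Omega -> 'cV[R]_nx)
    (u : nat -> Omega -> 'cV[R]_nu) (delta : R) :
  compact W ->
  (forall t, random_vector (fun o => col_mx (x t o) (u t o))) ->
  measurable [set o | (delta%:E <
    diam (membership_set W x (fun t o => col_mx (x t o) (u t o)) T o))%E].
Proof.
set z := fun t o => col_mx (x t o) (u t o) => cW mz.
(* The event depends on the outcome only through this stacked matrix: x_(t+1) is the upper part of
   z_(t+1), hence the [T.+1] rows. *)
pose Y o : 'M[R]_(T.+1, nx + nu) := \matrix_(t, i) z t o i 0.
have mY i j : measurable_fun setT (fun o => Y o i j).
  rewrite (_ : (fun o => _) = (fun v : borelV R (nx + nu) => v j 0) \o z i); last first.
    by apply/funext => o; rewrite mxE.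
  apply: measurableT_comp; last exact: mz.
  by apply: borel_continuous; exact: coord_continuous.
pose M := 'M[R]_(nx, nx + nu).
pose zt (t : 'I_T.+1) (q : 'M[R]_(T.+1, nx + nu) * (M * M)) := (row t q.1)^T.
pose res (b : bool) (t : 'I_T) q : 'cV[R]_nx :=
  usubmx (zt (lift ord0 t) q) -
    (if b then q.2.1 else q.2.2) *m zt (widen_ord (leqnSn T) t) q.
have czt t : continuous (zt t).
  apply: continuous_mx => i j q.
  rewrite (_ : (fun x => _) = fun q : 'M[R]_(T.+1, nx + nu) * (M * M) => q.1 t i).
    exact: (continuous_comp cvg_fst (@coord_continuous R _ _ t i _)).
  by apply/funext => q'; rewrite !mxE.
have cres b t : continuous (res b t).
  have c1 : continuous (fun q => usubmx (zt (lift ord0 t) q)).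
    apply: continuous_mx => i j q.
    rewrite (_ : (fun x => _) = fun q => zt (lift ord0 t) q (lshift nu i) j).
      exact: (continuous_comp (czt _ q) (@coord_continuous R _ _ _ _ _)).
    by apply/funext => q'; rewrite mxE.
  have c2 : continuous (fun q : 'M[R]_(T.+1, nx + nu) * (M * M) =>
      if b then q.2.1 else q.2.2).
    move=> q; case: b.
      exact: (continuous_comp cvg_snd cvg_fst).
    exact: (continuous_comp cvg_snd cvg_snd).
  move=> q; exact: (continuousB (c1 q) (continuous_mulmx c2 (czt _) (x := q))).
have clW : closed W by apply: compact_closed => //; exact: norm_hausdorff.
pose S := \bigcap_(b : bool) \bigcap_(t : 'I_T) (res b t) @^-1` W.
have cS : closed S.
  apply: closed_bigI => b _; apply: closed_bigI => t _.
  by apply: closed_comp => // q _; exact: cres.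
pose far (e : R) := [set p : M * M | e <= frobenius (p.1 - p.2)].
have cfar e : closed (far e).
  apply: (@closed_comp _ _ (fun p : M * M => frobenius (p.1 - p.2)) [set r | e <= r]).
    move=> p _.
    have cB : {for p, continuous (fun p : M * M => p.1 - p.2)}.
      by apply: continuousB; [exact: cvg_fst | exact: cvg_snd].
    exact: (continuous_comp cB (@continuous_frob R _ _ _)).
  exact: closed_ge.
pose box (k : R) := [set A : M | forall i j, A i j \in `[- k, k]].
(* Letting [k] grow exhausts both the unbounded pairs and the strict inequality: entries at most [k]
   in absolute value, distance at least delta + 1/(k + 1). *)
pose K k := (box k%:R `*` box k%:R) `&` far (delta + k.+1%:R^-1).
have cK k : compact (K k).
  by apply: compact_closedI => //; apply: compact_setX; exact: compact_box.
have E : [set o | (delta%:E < diam (membership_set W x z T o))%E] =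
    \bigcup_k (Y @^-1` [set y | exists2 p, K k p & S (y, p)]).
  have resE o b (t : 'I_T) p : res b t (Y o, p) =
      x t.+1 o - (if b then p.1 else p.2) *m z t o.
    rewrite /res /=; congr (_ - _); last congr (_ *m _).
      rewrite (_ : zt _ _ = z t.+1 o) ?col_mxKu //.
      by apply/matrixP => i j; rewrite mxE mxE mxE ord1.
    by apply/matrixP => i j; rewrite mxE mxE mxE ord1.
  apply/seteqP; split => [ o /= /ereal_sup_gt[_ [p [p1 p2] <-]]|o [k _ [p [_ /= pf] Sp]]].
    rewrite lte_fin => dp.
    pose e := frobenius (p.1 - p.2) - delta.
    pose k := maxn (Num.truncn e^-1) (Num.truncn (frobenius p.1 + frobenius p.2)).+1.
    have e0 : 0 < e by rewrite subr_gt0.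
    have kP : frobenius p.1 + frobenius p.2 <= k%:R.
      apply: le_trans (ltW (truncnS_gt _)) _; rewrite ler_nat; exact: leq_maxr.
    exists k => //; exists p.
      split; [split => i j; rewrite in_itv /= -ler_norml|].
      - apply: le_trans (entry_le_frob _ _ _) (le_trans _ kP).
        by rewrite lerDl frob_ge0.
      - apply: le_trans (entry_le_frob _ _ _) (le_trans _ kP).
        by rewrite lerDr frob_ge0.
      rewrite /far /= -lerBrDl -/e.
      rewrite -[leRHS]invrK lef_pV2 ?posrE ?invr_gt0 //.
      apply: le_trans (ltW (truncnS_gt _)) _; rewrite ler_nat ltnS; exact: leq_maxl.
    move=> b _ t _ /=; rewrite resE.
    by case: b; [exact: (p1 t (ltn_ord t)) | exact: (p2 t (ltn_ord t))].
  apply: lt_le_trans (_ : (frobenius (p.1 - p.2))%:E <= _)%E.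
    rewrite lte_fin; apply: lt_le_trans pf; rewrite ltrDl invr_gt0 //.
  apply: ereal_sup_ubound; exists p => //; split => t tT.
    by have := Sp true I (Ordinal tT) I; rewrite /= resE.
  by have := Sp false I (Ordinal tT) I; rewrite /= resE.
rewrite E; apply: bigcupT_measurable => k.
rewrite -[X in measurable X]setCK; apply: measurableC.
rewrite preimage_setC; apply: (preimage_open_measurable mY).
by apply: closed_openC; exact: closed_exists_compact.
Qed.

End Measurability.

(** * Rounding of vectors to a grid *)

Section Rounding.
Context {R : realType} {n : nat}.

(* The states are rounded to a grid so that the extremal boundary point is a
   function of a discrete variable, hence needs no measurable selection. *)
Definition roundv (h : R) (v : 'cV[R]_n) : 'cV[int]_n :=
  \col_i Num.floor (v i 0 / h).

Definition gridv (h : R) (k : 'cV[int]_n) : 'cV[R]_n := h *: map_mx intr k.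

Lemma frob_sub_roundv h v : 0 < h ->
  frobenius (v - gridv h (roundv h v)) <= n%:R * h.
Proof.
move=> h0; rewrite -[n in leRHS]muln1; apply: frob_le_bound; first exact: ltW.
move=> i j; rewrite (ord1 j) !mxE.
have /andP[] := floor_itv (v i 0 / h); rewrite intrD.
set k := (Num.floor _)%:~R; set y := v i 0 => k1 k2.
have -> : y - h * k = h * (y / h - k) by field; lra.
by rewrite normrM gtr0_norm // ger_pMr // ger0_norm; lra.
Qed.

Lemma sigma_rv_roundv (d : measure_display) (Omega : measurableType d)
    (X : Omega -> 'cV[R]_n) h k : sigma_rv X [set o | roundv h (X o) = k].
Proof.
apply: (@sigma_rv_preimage _ _ _ _ X [set v | roundv h v = k]).
rewrite (_ : mkset _ = \bigcap_(i : 'I_n)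
  ((fun v : 'cV[R]_n => v i 0 / h) @^-1` `[(k i 0)%:~R, (k i 0 + 1)%:~R[)).
  apply: (sigma_bigcap (@sigma_algebra_measurable _ (borelV R n))) => i _.
  rewrite -[X in measurable X]setTI; apply: (@borel_continuous R n _) => // v.
  exact: (continuous_comp (@coord_continuous R n 1 i 0 v)
    (@mulrr_continuous R (h^-1) _)).
apply/seteqP; split => [v <- i _|v H].
  by rewrite /= in_itv /= !mxE; exact: floor_itv.
apply/matrixP => i j; rewrite (ord1 j) mxE; apply: floor_def.
by have := H i I; rewrite /= in_itv.
Qed.

End Rounding.

(** * Probability bounds for the two failure events *)

Section Blocks.
Context {R : realType} {d : measure_display} {Omega : measurableType d}.
Context {nx nz : nat}.
Variables (P : probability Omega R).
Variables (w : nat -> Omega -> 'cV[R]_nx) (z : nat -> Omega -> 'cV[R]_nz).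
Hypothesis mw : forall t, random_vector (w t).
Hypothesis mz : forall t, random_vector (z t).

Definition grid_hit (G : 'M[R]_(nx, nz)) (c h : R) (s : nat) : set Omega :=
  [set o | c <= frobenius (G *m gridv h (roundv h (z s o)))].

Definition grid_away (w0 : 'cV[int]_nz -> 'cV[R]_nx) (eta h : R) (s : nat) :
  set Omega := [set o | eta <= frobenius (w0 (roundv h (z s o)) - w s o)].

Lemma Pr_grid_blocks (W : set 'cV[R]_nx) (q : R -> R) G c h eta w0 m K :
  nonanticipative P w z -> boundary_visiting P W w q -> 0 < eta ->
  (forall k, boundary W (w0 k)) ->
  let E := [set o | forall k, (k < K)%N ->
    first_hit_bad (grid_hit G c h) (grid_away w0 eta h) (k * m).+1 m o] in
  measurable E /\ Pr P E <= (1 - q eta) ^+ K.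
Proof.
move=> na bv eta0 bw0 E.
have sF := filtration_sigma w z.
have Fm := filtration_measurable mw mz.
have FY s k : filtration w z s [set o | roundv h (z s o) = k].
  by apply: filtration_z (leqnn s) _ _; exact: sigma_rv_roundv.
have q1 : 0 <= 1 - q eta.
  have [_ /(_ 0%N _ (bw0 0)) H] := bv _ eta0.
  have [sB _] := noise_away_le mw mz na bv eta0 (bw0 0) (sigmaT (sF 0%N)).
  have mB := sigma_rv_measurable (@mw 0%N) sB.
  rewrite subr_ge0 -lee_fin; apply: le_trans H _; apply: probability_le1.
  rewrite (_ : mkset _ = ~` [set o | eta <= frobenius (w0 0 - w 0%N o)]).
    exact: measurableC.
  by apply/seteqP; split => o /=; rewrite ltNge => /negP.
have Fhit s : filtration w z s (grid_hit G c h s).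
  rewrite (_ : grid_hit G c h s = \bigcup_(k in [set k | c <= frobenius (G *m gridv h k)])
      [set o | roundv h (z s o) = k]).
    by apply: (sigma_bigcup (sF s)) => k _; exact: FY.
  apply/seteqP; split => [ o Ho|o [k ck /= zk]]; first by exists (roundv h (z s o)).
  by rewrite /grid_hit /= zk.
have sw s k : sigma_rv (w s) [set o | eta <= frobenius (w0 k - w s o)].
  by have [] := noise_away_le mw mz na bv eta0 (bw0 k) (sigmaT (sF s)).
have Faway s : filtration w z s.+1 (grid_away w0 eta h s).
  rewrite (_ : grid_away w0 eta h s = \bigcup_k ([set o | roundv h (z s o) = k] `&`
      [set o | eta <= frobenius (w0 k - w s o)])).
    apply: (sigma_bigcup (sF s.+1)) => k _; apply: (sigmaI (sF s.+1)).
      exact: filtration_mono (leqnSn s) _ (FY s k).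
    exact: filtration_w (ltnSn s) _ (sw s k).
  apply/seteqP; split => [ o Ho|o [k _ [/= zk]]]; first by exists (roundv h (z s o)).
  by rewrite /grid_away /= zk.
have Paway s A : filtration w z s A ->
    Pr P (A `&` grid_away w0 eta h s) <= (1 - q eta) * Pr P A.
  move=> FA.
  (* For a fixed rounded state the boundary point is fixed; the mixture lemma lets the state be
     random. *)
  apply: (Pr_mix_le (B := fun k => [set o | eta <= frobenius (w0 k - w s o)])
    (sF s) (Fm s) q1 (FY s)) => [k|k B FB|//].
    exact: sigma_rv_measurable (@mw s) _ (sw s k).
  by have [] := noise_away_le mw mz na bv eta0 (bw0 k) FB.
have [FE PE] := Pr_all_blocks sF Fm (filtration_mono (w := w) (z := z)) q1 Fhit
  Faway Paway m K.
by split => //; exact: Fm FE.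
Qed.

(* The exponent [m.-1] instead of [m] costs a constant factor; it is forced by
   the BMSB condition, which says nothing about [z 1]. *)
Lemma exp_count_bound (p : R) (m : nat) : 0 < p <= 1 -> (0 < m)%N ->
  2%:R ^+ (Num.truncn (p * m%:R / 2%:R)).+1 * (1 - p / 2%:R) ^+ m.-1 <=
  expR (5%:R / 4%:R) * expR (- (1 / 8%:R * p ^+ 2) * m%:R).
Proof.
move=> /andP[p0 p1] m0.
have e2 : 2%:R <= expR (3%:R / 4%:R) :> R.
  have -> : 3%:R / 4%:R = 8%:R * (3%:R / 32%:R) :> R by lra.
  rewrite expRM_natl.
  have H : 1 + 3%:R / 32%:R <= expR (3%:R / 32%:R) :> R by exact: expR_ge1Dx.
  apply: (@le_trans _ _ ((1 + 3%:R / 32%:R) ^+ 8)); first lra.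
  by rewrite lerXn2r ?nnegrE ?expR_ge0 //; lra.
have ep : 1 - p / 2%:R <= expR (- (p / 2%:R)) by exact: expR_ge1Dx.
set n := (Num.truncn _).+1.
have nle : n%:R <= p * m%:R / 2%:R + 1.
  by rewrite /n -natr1 lerD2r truncn_le // divr_ge0 // mulr_ge0 // ltW.
apply: (@le_trans _ _ (expR (3%:R / 4%:R) ^+ n * expR (- (p / 2%:R)) ^+ m.-1)).
  by apply: ler_pM; rewrite ?exprn_ge0 ?lerXn2r ?nnegrE ?expR_ge0 //; lra.
(* The exponent is at most (3/4)(p m/2 + 1) - (p/2)(m - 1) = 3/4 + p/2 - p m/8, and p^2 <= p <= 1
   turns this into 5/4 - p^2 m/8. *)
rewrite -!expRM_natl -!expRD ler_expR.
have mE : m%:R = m.-1%:R + 1 :> R by rewrite natr1 prednK.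
have : 0 <= m.-1%:R :> R by [].
rewrite mE in nle *; move: (m.-1%:R) (n%:R) nle => y N nle y0.
have : p ^+ 2 * (y + 1) <= p * (y + 1) by rewrite ler_wpM2r //; nra.
nra.
Qed.

(** The count runs along the filtration shifted by [t]. In a block starting at [t] it covers the
    last m - 1 times, as conditioning on time [t] informs on z from t + 1 on. *)
Lemma Pr_few_hits (sig p : R) : 0 < p <= 1 -> bmsb P w z sig p ->
  forall (g : 'cV[R]_nz) (t m : nat), (1 <= t)%N -> (0 < m)%N ->
  let E := [set o | (\sum_(i < m.-1)
      (sig * frobenius g <= `|dotv g (z (t + i).+1 o)|)%R <
      (Num.truncn (p * m%:R / 2%:R)).+1)%N] in
  measurable E /\
  Pr P E <= expR (5%:R / 4%:R) * expR (- (1 / 8%:R * p ^+ 2) * m%:R).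
Proof.
move=> p01 hb g t m t1 m0 E.
have sF i : sigma_algebra setT (filtration w z (t + i)) by exact: filtration_sigma.
have Fm i : filtration w z (t + i) `<=` measurable by exact: filtration_measurable.
have Fmono i j : (i <= j)%N -> filtration w z (t + i) `<=` filtration w z (t + j).
  by move=> ij; apply: filtration_mono; rewrite leq_add2l.
pose H i := [set o | sig * frobenius g <= `|dotv g (z (t + i).+1 o)|].
have FH i : filtration w z (t + i.+1) (H i).
  rewrite addnS; apply: filtration_z (leqnn _) _ _; exact: sigma_rv_dotv_ge.
have p01' : 0 <= p <= 1 by move/andP: p01 => [/ltW -> ->].
have PH i A : filtration w z (t + i) A -> p * Pr P A <= Pr P (A `&` H i).
  move=> FA; apply: (bmsb_le mw mz p01' hb) => //; exact: leq_trans t1 (leq_addr _ _).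
have [FE PE] := Pr_count_hits_lt sF Fm Fmono p01' FH PH m.-1
  (Num.truncn (p * m%:R / 2%:R)).+1.
have <- : [set o | (count_hits H m.-1 o < (Num.truncn (p * m%:R / 2%:R)).+1)%N] = E.
  have cE o : count_hits H m.-1 o = (\sum_(i < m.-1)
      (sig * frobenius g <= `|dotv g (z (t + i).+1 o)|)%R)%N.
    apply: eq_bigr => i _; congr nat_of_bool; apply/idP/idP => [/set_mem//|?].
    exact/mem_set.
  by apply/seteqP; split => o; rewrite /= cE.
by split; [exact: Fm FE | apply: le_trans PE (exp_count_bound _ _)].
Qed.

End Blocks.

(** * Consequences of a large diameter for a single outcome *)

Section Tail.
Context {R : realType} {d : measure_display} {Omega : measurableType d}.
Context {nx nu : nat}.
Let nz := (nx + nu)%N.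
Variables (P : probability Omega R).
Variables (x : nat -> Omega -> 'cV[R]_nx) (u : nat -> Omega -> 'cV[R]_nu).
Let z := fun t o => col_mx (x t o) (u t o) : 'cV[R]_nz.
Variables (w : nat -> Omega -> 'cV[R]_nx) (theta : 'M[R]_(nx, nz)).
Variable W : set 'cV[R]_nx.
Hypothesis hsys : forall t o, x t.+1 o = theta *m z t o + w t o.

(** By the triangle inequality, of two members more than delta apart one is more than delta/2 away
    from [theta]; its residual at time t is w_t minus the error applied to z_t. *)
Lemma parameter_far_from_truth (T : nat) (delta : R) (o : Omega) :
  (delta%:E < diam (membership_set W x z T o))%E ->
  exists2 ga : 'M[R]_(nx, nz), delta / 2%:R < frobenius ga &
    forall t, (t < T)%N -> W (w t o - ga *m z t o).
Proof.
move=> /ereal_sup_gt[_ [p [p1 p2] <-]]; rewrite lte_fin => dp.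
have H th t : membership_set W x z T o th -> (t < T)%N ->
    W (w t o - (th - theta) *m z t o).
  move=> /(_ t) H tT; have := H tT; rewrite /= hsys mulmxBl opprB addrA.
  by rewrite [w t o + _]addrC.
have [d1|d1] := ltP (delta / 2%:R) (frobenius (p.1 - theta)).
  by exists (p.1 - theta) => // t; exact: H.
exists (p.2 - theta) => [|t]; last exact: H.
have := frob_triangle (p.1 - theta) (theta - p.2).
by rewrite addrA subrK (frob_distC theta); lra.
Qed.

(* With a_1 = S/4, [63/100 S] bounds the energy from below, [38/100 S] is what
   is left after rounding and passing to the net, and
   [38/100 - 25/100 = 13/100 > 1/8] is the slack in the last estimate. *)
Lemma blocks_of_large_parameter (T m K : nat) (S bz sig p delta h : R)
    (s1 : seq 'cV[R]_nz) (s2 : seq 'M[R]_(nx, nz))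
    (w0 : 'M[R]_(nx, nz) -> 'cV[int]_nz -> 'cV[R]_nx) (o : Omega) :
  0 < p <= 1 -> 0 < sig <= bz -> S = sig * p -> (0 < m)%N -> (K * m < T)%N ->
  0 < delta -> 0 < h -> nz%:R * h <= S / 120%:R ->
  (forall l : 'cV[R]_nz, frobenius l = 1 ->
     exists2 g, g \in s1 & frobenius (l - g) <= sig * p / (20%:R * bz)) ->
  (forall l : 'M[R]_(nx, nz), frobenius l = 1 ->
     exists2 g, g \in s2 & frobenius (l - g) <= 10%:R * S / (43%:R * bz)) ->
  (forall G k y, W y -> dotv (- (G *m gridv h k)) y <=
     dotv (- (G *m gridv h k)) (w0 G k)) ->
  (forall t, frobenius (z t o) <= bz) ->
  (forall k g, (k < K)%N -> g \in s1 ->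
    ((Num.truncn (p * m%:R / 2%:R)).+1 <= \sum_(i < m.-1)
      (sig * frobenius g <= `|dotv g (z ((k * m).+1 + i).+1 o)|)%R)%N) ->
  (delta%:E < diam (membership_set W x z T o))%E ->
  exists2 G, G \in s2 & forall k, (k < K)%N ->
    first_hit_bad (grid_hit z G (38%:R / 100%:R * S) h)
      (grid_away w z (w0 G) (1 / 4%:R * S * delta / 4%:R) h) (k * m).+1 m o.
Proof.
move=> p01 sb SE m0 KmT delta0 h0 hS net1 net2 w0max zb hits
  /parameter_far_from_truth[ga gad gaW].
have /andP[p0 p1] := p01; have /andP[sig0 sigb] := sb.
have S0 : 0 < S by rewrite SE mulr_gt0.
have b0 : 0 < bz by exact: lt_le_trans sigb.
set r := frobenius ga in gad; have r0 : 0 < r by lra.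
pose ga1 := r^-1 *: ga.
have ga11 : frobenius ga1 = 1.
  by rewrite frobZ gtr0_norm ?invr_gt0 // mulVf // gt_eqF.
have gaE : ga = r *: ga1 by rewrite scalerA mulfV ?scale1r // gt_eqF.
have [G Gs2 gaG] := net2 _ ga11.
exists G => // k kK.
(* Net error and two rounding terms: 10/43 S + 2 S/120 < S/4. *)
have close s : frobenius (ga1 *m z s o - G *m gridv h (roundv h (z s o))) <= S / 4%:R.
  have e0 : 0 <= 10%:R * S / (43%:R * bz) by rewrite divr_ge0 // mulr_ge0 // ltW.
  apply: le_trans (approx_mulmx e0 ga11 gaG
    (le_trans (frob_sub_roundv _ h0) hS) (zb s)) _.
  have E : 10%:R * S / (43%:R * bz) * bz = 10%:R / 43%:R * S by field; lra.
  have e1 : 10%:R * S / (43%:R * bz) <= 1.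
    by rewrite ler_pdivrMr ?mulr_gt0 // SE; nra.
  have : 10%:R * S / (43%:R * bz) * (S / 120%:R) <= S / 120%:R.
    by apply: ler_piMl => //; lra.
  by rewrite mulrDr E; lra.
have away s : (s < T)%N -> grid_hit z G (38%:R / 100%:R * S) h s o ->
    grid_away w z (w0 G) (1 / 4%:R * S * delta / 4%:R) h s o.
  move=> sT; rewrite /grid_hit /grid_away /=.
  set v := G *m _ => hv; have fv : 0 < frobenius v by apply: lt_le_trans hv; lra.
  apply: (noise_away_of_member (v := v) _ (w0max G _) _ (gaW s sT)).
    apply/eqP => v0; move: fv.
    by rewrite v0 frob0 ltxx.
  rewrite gaE -scalemxAl dotvZr.
  have -> : ga1 *m z s o = v + (ga1 *m z s o - v) by rewrite addrC subrK.
  rewrite dotvDr dotvv.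
  have := dotv_le v (ga1 *m z s o - v); rewrite ler_norml => /andP[D _].
  have C := close s; rewrite -/v in C.
  have D2 : 13%:R / 100%:R * S * frobenius v <=
      frobenius v ^+ 2 + dotv v (ga1 *m z s o - v).
    have := ler_wpM2l (ltW fv) hv; have := ler_wpM2l (ltW fv) C.
    by rewrite expr2; move: D; set c := frobenius (_ - _); lra.
  have D3 : r * (13%:R / 100%:R * S * frobenius v) <=
      r * (frobenius v ^+ 2 + dotv v (ga1 *m z s o - v)) by rewrite ler_pM2l.
  apply: le_trans D3; have X0 : 0 < S * frobenius v by rewrite mulr_gt0.
  rewrite [leLHS](_ : _ = delta / 16%:R * (S * frobenius v)); last by field.
  rewrite [leRHS](_ : _ = 13%:R / 100%:R * r * (S * frobenius v)); last by ring.
  by rewrite ler_pM2r //; lra.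
have [|j jm hj] := excitation (z := fun i => z ((k * m).+1 + i).+1 o) (m := m)
    p01 sb net1 _ (hits k ^~ kK) (leq_pred m) m0 (ltW (truncnS_gt _)) ga11.
  by [].
have ex : exists j, (j < m)%N &&
    `[< grid_hit z G (38%:R / 100%:R * S) h ((k * m).+1 + j)%N o >].
  (* [excitation] numbers the last m - 1 times of the block, so its index [j] is offset [j.+1]; the
     level drops from 63/100 S to 38/100 S by the error S/4. *)
  exists j.+1; rewrite -ltn_predRL jm /=; apply/asboolP.
  rewrite addnS /grid_hit /=; have := close ((k * m).+1 + j).+1.
  have := frob_sub_ge (ga1 *m z ((k * m).+1 + j).+1 o)
    (G *m gridv h (roundv h (z ((k * m).+1 + j).+1 o))).
  by move: hj; rewrite -SE; lra.
case: (ex_minnP ex) => i /andP[im /asboolP hi] imin.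
exists i; split => //.
  move=> i' ii' hi'; have := imin i'; rewrite (ltn_trans ii' im) /=.
  by move=> /(_ (asboolT hi')); rewrite leqNgt ii'.
(* The last time of block [k] is (k + 1) m, at most K m and so less than T. *)
apply: away => //; apply: leq_trans KmT; rewrite ltnS addSn.
apply: (@leq_trans (k.+1 * m)); last by rewrite leq_mul2r kK orbT.
by rewrite mulSn addnC ltn_add2r.
Qed.

End Tail.

(** * Soft-O constants, union bounds and the final estimate *)

Section Assembly.
Context {R : realType}.

(** The zeroth power of the logarithm works, as n^(5/2) >= 1 once n >= 1. *)
Lemma soft_bigO_const (c : R) :
  soft_bigO (fun=> c) (fun n : nat => n%:R `^ (5 / 2)).
Proof.
exists 0%N; apply/eqO_exP; exists (`|c| + 1); first by rewrite ltr_pwDr.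
near=> n; rewrite expr0 mulr1 /=.
have n1 : (0 < n)%N by near: n; exact: nbhs_infty_gt.
have H : 1 <= n%:R `^ (5 / 2) :> R.
  rewrite -[leLHS](powRr0 n%:R); apply: ler_powR; first by rewrite ler1n.
  by rewrite divr_ge0.
rewrite [X in _ * X]ger0_norm ?(le_trans ler01) //.
by have := normr_ge0 c; nra.
Unshelve. all: by end_near.
Qed.

Context {d : measure_display} {Omega : measurableType d}.
Variable P : probability Omega R.

Lemma ae_null_cover (Q : Omega -> Prop) : {ae P, forall o, Q o} ->
  exists N, [/\ measurable N, Pr P N = 0 & forall o, ~ N o -> Q o].
Proof.
move=> [N [mN PN QN]]; exists N; split => //; first by rewrite /Pr PN.
by move=> o No; apply: contrapT => nQ; apply: No; exact: QN.
Qed.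

Lemma Pr_cover_le (I : eqType) (s : seq I) (A : I -> set Omega) (b : R) :
  (forall i, measurable (A i)) -> (forall i, i \in s -> Pr P (A i) <= b) ->
  measurable (\big[setU/set0]_(i <- s) A i) /\
  Pr P (\big[setU/set0]_(i <- s) A i) <= (size s)%:R * b.
Proof.
move=> mA Ab; have [mU PU] := Pr_le_cover P s mA; split => //.
apply: le_trans PU _.
rewrite mulr_natl -iter_addr_0 -count_predT -big_const_seq big_seq [leRHS]big_seq.
by apply: ler_sum => i; exact: Ab.
Qed.

Lemma mem_big_setU (I : eqType) (s : seq I) (A : I -> set Omega) i o :
  i \in s -> A i o -> (\big[setU/set0]_(i <- s) A i) o.
Proof.
elim: s => // j s IH; rewrite inE big_cons => /orP[/eqP <- ?|/IH H /H ?].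
  by left.
by right.
Qed.

End Assembly.

Theorem theorem1 (R : realType) :
  exists f1 f2 : nat -> R,
    [/\ soft_bigO f1 (fun n : nat => n%:R `^ (5 / 2)),
        soft_bigO f2 (fun n : nat => n%:R `^ (5 / 2)) &
        forall (nx nu : nat) (nz := (nx + nu)%N) (hnx : (0 < nx)%N)
          (d : measure_display) (Omega : measurableType d)
          (P : probability Omega R)
          (x : nat -> Omega -> 'cV[R]_nx) (u : nat -> Omega -> 'cV[R]_nu)
          (z := fun t o => col_mx (x t o) (u t o) : 'cV[R]_nz)
          (w : nat -> Omega -> 'cV[R]_nx) (theta : 'M[R]_(nx, nz))
          (W : set 'cV[R]_nx) (Sigmaw : 'M[R]_nx)
          (bz sigmaz pz : R) (qw : R -> R)
          (hz : forall t, random_vector (z t))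
          (hsys : forall t o, x t.+1 o = theta *m z t o + w t o)
          (hcausal : nonanticipative P w z)
          (hA : iid_bounded_noise P W w Sigmaw)
          (hB : bounded_bmsb P w z bz sigmaz pz)
          (hC : boundary_visiting P W w qw)
          (a1 := 1 / 4 * sigmaz * pz)
          (a2 := Num.max 1 (64 * bz ^+ 2 / (sigmaz ^+ 2 * pz ^+ 2)))
          (a3 := 1 / 8 * pz ^+ 2)
          (a4 := Num.max 1 (4 * bz / a1))
          (T m : nat) (hm : (1 <= m < T)%N) (delta : R) (hdelta : 0 < delta),
        (P [set o | (delta%:E < diam (membership_set W x z T o))%E] <=
         (T%:R / m%:R * f1 nz * a2 ^+ nz * expR (- a3 * m%:R) +
          f2 (nx * nz)%N * a4 ^+ (nx * nz) *
            (1 - qw (a1 * delta / 4)) ^ (Num.ceil (T%:R / m%:R : R) - 1))%:E)%E].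
Proof.
(* exp(5/4) is the constant of [exp_count_bound]; the second is 1 because a_4^(nx nz) bounds the
   whole net of parameters. *)
exists (fun=> expR (5 / 4)), (fun=> 1); split; try exact: soft_bigO_const.
move=> nx nu nz hnx d Omega P x u z w theta W Sigmaw bz sigmaz pz qw hz hsys
  hcausal hA hB hC a1 a2 a3 a4 T m /andP[m0 mT] delta delta0.
have mw := noise_random hA.
have cW := support_compact hA.
have W0 : W !=set0.
  by have [y Wy] := support_interior hA; exists y; exact: nbhs_singleton.
have [zb sig0 p01 hb] := hB.
have /andP[p0 p1] := p01.
have nz0 : (0 < nz)%N by rewrite ltn_addr.
have [N0 [mN0 PN0 N0P]] := ae_null_cover (ae_foralln zb).
set S := sigmaz * pz; have S0 : 0 < S by rewrite mulr_gt0.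
(* For a unit vector e, |<e, z_2>| is at least sigma_z with probability at least p_z > 0, and at
   most b_z almost surely. *)
have sb : sigmaz <= bz.
  pose e : 'cV[R]_nz := delta_mx (Ordinal nz0) 0.
  have e1 : frobenius e = 1.
    apply/eqP; rewrite -(eqrXn2 (n := 2)) ?frob_ge0 // expr1n frob_sqr.
    rewrite /sqnorm (bigD1 (Ordinal nz0)) //= big_ord1 mxE !eqxx expr1n.
    rewrite big1 ?addr0 // => i ine; rewrite big_ord1 mxE (negbTE ine) expr0n.
    by [].
  have p01' : 0 <= pz <= 1 by rewrite ltW.
  have := bmsb_le mw hz p01' hb e (leqnn 1) (sigmaT (filtration_sigma w z 1)).
  rewrite PrT mulr1 setTI e1 mulr1; set E := mkset _ => pE.
  rewrite leNgt; apply/negP => bs.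
  have : Pr P E <= Pr P N0.
    apply: Pr_le => //.
      by apply: sigma_rv_measurable (hz 2) _ _; exact: sigma_rv_dotv_ge.
    move=> o Eo; apply: contrapT => /N0P /(_ 2%N) zo.
    have := dotv_le e (z 2%N o); rewrite e1 mul1r; move: Eo; rewrite /E /=; lra.
  by rewrite PN0; lra.
have b0 : 0 < bz by exact: lt_le_trans sb.
have Sb : S <= bz by rewrite /S; nra.
(* With rho = b_z/S >= 1 the base of the net size is 2.81 (20 rho + 1.36) <= 64 rho^2, the second
   term of a_2. *)
have [s1 [s1size s1net]] : exists s1 : seq 'cV[R]_nz, (size s1)%:R <= a2 ^+ nz /\
    forall l : 'cV[R]_nz, frobenius l = 1 ->
     exists2 g, g \in s1 & frobenius (l - g) <= sigmaz * pz / (20%:R * bz).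
  have e01 : 0 < S / (20%:R * bz) <= 1 / 4%:R.
    rewrite divr_gt0 ?mulr_gt0 //= ler_pdivrMr ?mulr_gt0 //; lra.
  have [s [ss sn]] := @sphere_net R nz 1 _ e01; exists s; split; last exact: sn.
  apply: le_trans ss _; rewrite muln1; apply: lerXn2r; rewrite ?nnegrE.
  - rewrite mulr_ge0 // addr_ge0 // divr_ge0 // ltW //.
    by case/andP: e01.
  - by rewrite le_max ler01.
  rewrite le_max; apply/orP; right.

  have -> : sigmaz ^+ 2 * pz ^+ 2 = S ^+ 2 by rewrite exprMn.
  have -> : 1 / (S / (20%:R * bz)) = 20%:R * (bz / S) by field; lra.
  have -> : 64 * bz ^+ 2 / S ^+ 2 = 64 * (bz / S) ^+ 2 by field; lra.
  have : 1 <= bz / S by rewrite ler_pdivlMr // mul1r.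
  by move: (bz / S) => rho; nra.
(* Here 2.81 (4.3 rho + 1.36) <= 16 rho = 4 b_z/a_1. *)
have [s2 [s2size s2net]] : exists s2 : seq 'M[R]_(nx, nz),
    (size s2)%:R <= a4 ^+ (nx * nz) /\
    forall l : 'M[R]_(nx, nz), frobenius l = 1 ->
     exists2 g, g \in s2 & frobenius (l - g) <= 10%:R * S / (43%:R * bz).
  have e01 : 0 < 10%:R * S / (43%:R * bz) <= 1 / 4%:R.
    rewrite divr_gt0 ?mulr_gt0 //= ler_pdivrMr ?mulr_gt0 //; lra.
  have [s [ss sn]] := @sphere_net R nx nz _ e01; exists s; split; last exact: sn.
  apply: le_trans ss _; apply: lerXn2r; rewrite ?nnegrE.
  - rewrite mulr_ge0 // addr_ge0 // divr_ge0 // ltW //.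
    by case/andP: e01.
  - by rewrite le_max ler01.
  rewrite le_max; apply/orP; right.
  have -> : 4 * bz / a1 = 16%:R * (bz / S) by rewrite /a1 /S; field; lra.
  have -> : 1 / (10%:R * S / (43%:R * bz)) = 43%:R / 10%:R * (bz / S).
    by field; lra.
  have : 1 <= bz / S by rewrite ler_pdivlMr // mul1r.
  by move: (bz / S) => rho; lra.
have bdry (v : 'cV[R]_nx) := support_boundary_point v hnx cW W0.
have nzR : 0 < nz%:R :> R by rewrite ltr0n.
(* This mesh keeps the rounding error of z_t within S/120. *)
pose h := S / (120%:R * nz%:R).
have h0 : 0 < h by rewrite divr_gt0 // mulr_gt0.
have hS : nz%:R * h <= S / 120%:R.
  by rewrite /h le_eqVlt; apply/orP; left; apply/eqP; field; lra.
pose w0 (G : 'M[R]_(nx, nz)) (k : 'cV[int]_nz) : 'cV[R]_nx :=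
  projT1 (cid (bdry (- (G *m gridv h k)))).
have w0b G k : boundary W (w0 G k) by rewrite /w0; case: cid => ? [].
have w0max G k y : W y -> dotv (- (G *m gridv h k)) y <=
    dotv (- (G *m gridv h k)) (w0 G k).
  by rewrite /w0; case: cid => ? [_] /=; exact.
pose eta := a1 * delta / 4.
have eta0 : 0 < eta by rewrite /eta /a1 divr_gt0 // !mulr_gt0.
have etaE : eta = 1 / 4%:R * S * delta / 4%:R by rewrite /eta /a1 /S mulrA.
have mR : 0 < m%:R :> R by rewrite ltr0n.
(* Since m < T the ceiling is at least 2, so the integer exponent is a natural number [K]; a ceiling
   minus one lies strictly below its argument, so K m < T. *)
have c1 : (1 : int) <= Num.ceil (T%:R / m%:R : R) - 1.
  rewrite lerBrDr lezD1 ceil_gt_int.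
  by rewrite ltr_pdivlMr // mul1r ltr_nat.
pose K := absz (Num.ceil (T%:R / m%:R : R) - 1).
have KE : Num.ceil (T%:R / m%:R : R) - 1 = K%:Z.
  by rewrite /K gez0_abs // (le_trans _ c1).
have KT : K%:R < T%:R / m%:R :> R.
  have := ceil_itv (T%:R / m%:R : R); rewrite KE => /andP[].
  by rewrite -pmulrn.
have KmT : (K * m < T)%N.
  by rewrite -(ltr_nat R) natrM -ltr_pdivlMr.
pose A1 (kg : nat * 'cV[R]_nz) := [set o | (\sum_(i < m.-1)
      (sigmaz * frobenius kg.2 <= `|dotv kg.2 (z ((kg.1 * m).+1 + i).+1 o)|)%R <
      (Num.truncn (pz * m%:R / 2%:R)).+1)%N].
pose b1 := expR (5 / 4) * expR (- a3 * m%:R).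
have HA1 kg : measurable (A1 kg) /\ Pr P (A1 kg) <= b1.
  exact: (Pr_few_hits mw hz p01 hb).
(* One event per block and net vector; the number of blocks is K < T/m. *)
pose I1 := [seq (k, g) | k <- iota 0 K, g <- s1].
have [mU1 PU1] := Pr_cover_le (s := I1) (fun kg => (HA1 kg).1) (fun kg _ => (HA1 kg).2).
pose A2 G := [set o | forall k, (k < K)%N ->
    first_hit_bad (grid_hit z G (38%:R / 100%:R * S) h)
      (grid_away w z (w0 G) eta h) (k * m).+1 m o].
have HA2 G : measurable (A2 G) /\ Pr P (A2 G) <= (1 - qw eta) ^+ K.
  exact: (@Pr_grid_blocks _ _ _ _ _ P w z mw hz W qw G (38%:R / 100%:R * S) h
    eta (w0 G) m K hcausal hC eta0 (w0b G)).
have [mU2 PU2] := Pr_cover_le (s := s2) (fun G => (HA2 G).1) (fun G _ => (HA2 G).2).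
set D := mkset _; have mD : measurable D by exact: diam_gt_measurable.
rewrite KE -exprnP (PrE P mD) lee_fin -/eta.
set U1 := \big[_/_]_(_ <- I1) _ in mU1 PU1; set U2 := \big[_/_]_(_ <- s2) _ in mU2 PU2.
have mU12 := measurableU _ _ mU1 mU2.
(* Off [N0] and [U1] every net vector is hit often in every block, and then a large diameter forces
   [A2 G] for some net point [G]. *)
have : D `<=` N0 `|` (U1 `|` U2).
  move=> o Do; apply: contrapT => no.
  have nN0 : ~ N0 o by move=> ?; apply: no; left.
  have nU1 : ~ U1 o by move=> ?; apply: no; right; left.
  have nU2 : ~ U2 o by move=> ?; apply: no; right; right.
  have hits k g : (k < K)%N -> g \in s1 ->
    ((Num.truncn (pz * m%:R / 2%:R)).+1 <= \sum_(i < m.-1)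
      (sigmaz * frobenius g <= `|dotv g (z ((k * m).+1 + i).+1 o)|)%R)%N.
    move=> kK gs; rewrite leqNgt; apply/negP => lt; apply: nU1.
    apply: (mem_big_setU (s := I1) (A := A1) (i := (k, g))) => //.
    by apply: allpairs_f => //; rewrite mem_iota.
  have [G Gs HG] := blocks_of_large_parameter hsys p01 (introT andP (conj sig0 sb))
    (erefl S) m0 KmT delta0 h0 hS s1net s2net w0max (N0P o nN0) hits Do.
  apply: nU2; apply: (mem_big_setU (s := s2) (A := A2) (i := G)) => //.
  by rewrite /A2 /= etaE.
move=> /(Pr_le P mD (measurableU _ _ mN0 mU12)) /le_trans; apply.
apply: le_trans (Pr_leU P mN0 mU12) _; rewrite PN0 add0r.
apply: le_trans (Pr_leU P mU1 mU2) _; rewrite mul1r; apply: lerD.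
  apply: le_trans PU1 _; rewrite size_allpairs size_iota natrM.
  rewrite [leRHS](_ : _ = T%:R / m%:R * a2 ^+ nz * b1); last by rewrite /b1; ring.
  apply: ler_wpM2r; first by rewrite mulr_ge0 ?expR_ge0.
  by apply: ler_pM => //; exact: ltW.
apply: le_trans PU2 _; apply: ler_wpM2r => //.
(* The common factor is nonnegative because it dominates a probability. *)
have [mA0 PA0] := HA2 0; exact: le_trans (Pr_ge0 P (A2 0)) PA0.
Qed.
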